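(* Let $l>0$, $m\ge 1$, $A_0>0$, $A_1,\dots,A_{2m}\in\mathbb{R}$, $\sigma>0$, put $\mathbb{A}=\sum_{n=0}^{2m}A_n\frac{\partial^n}{\partial x^n}$, and let $(W(t,\omega))_{t\ge 0}$ be a Wiener process on a probability space $(\Omega,\mathcal{F},P)$. Consider the $\mathbb{C}[-l,l[$-valued stochastic process $(\xi(t,\cdot,\omega))_{t\ge 0}$ defined by $$\xi(t,\cdot,\omega)=e^{t\mathbb{A}}\theta+\sigma\int_0^t e^{(t-\tau)\mathbb{A}}I_{[-l,l[}\,dW(\tau,\omega),$$ where $\theta\in FD^{(0)}[-l,l[$. Assume that the regularity condition (R) stated in the context is satisfied. For a fixed $t_0>0$, denote by $\mu_\theta$ the probability measure on $\mathbb{C}[-l,l[$ defined by the random element $\omega\mapsto\xi(t_0,\cdot,\omega)$. For $(Z_k)_{k\in\mathbb{N}}\in(\mathbb{C}[-l,l[)^{\mathbb{N}}$ put $T_n((Z_k)_{k\in\mathbb{N}})=e^{-t_0\mathbb{A}}\big(\frac{1}{n}\sum_{k=1}^n Z_k\big)$, $n\in\mathbb{N}$. Let $\theta^*\in FD^{(0)}[-l,l[$. For $(Z_k)_{k\in\mathbb{N}}\in(\mathbb{C}[-l,l[)^{\mathbb{N}}$ put $T((Z_k)_{k\in\mathbb{N}})=\lim_{n\to\infty}T_n((Z_k)_{k\in\mathbb{N}})$ if the sequence $(T_n((Z_k)_{k\in\mathbb{N}}))_{n\in\mathbb{N}}$ is convergent and this limit belongs to the class $FD^{(0)}[-l,l[$,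 and $T((Z_k)_{k\in\mathbb{N}})=\theta^*$ otherwise. Then $T:(\mathbb{C}[-l,l[)^{\mathbb{N}}\to FD^{(0)}[-l,l[$ is an infinite-sample consistent estimate of the useful signal $\theta\in FD^{(0)}[-l,l[$ with respect to the family $(\mu_\theta^{\mathbb{N}})$, in the sense that $$\mu_\theta^{\mathbb{N}}\big(\{(Z_k)_{k\in\mathbb{N}}\in(\mathbb{C}[-l,l[)^{\mathbb{N}}:\ T((Z_k)_{k\in\mathbb{N}})=\theta\}\big)=1$$ for each $\theta\in FD^{(0)}[-l,l[$.
   Context: $[-l,l[$ is the half-open interval $\{x:-l\le x<l\}$ and $I_{[-l,l[}$ is its indicator function (the constant function $1$ on $[-l,l[$). $\mathbb{C}[-l,l[$ is the Banach space of all real-valued bounded continuous functions on $[-l,l[$ with the supremum norm $\|\cdot\|$; convergence of $T_n$ is with respect to this norm. $FD^{(0)}[-l,l[\subset\mathbb{C}[-l,l[$ is the vector space of those functions whose Fourier series (with respect to $\cos(k\pi x/l),\sin(k\pi x/l)$) converges to the function at every point of $[-l,l[$. $FD^{(2m)}[-l,l[$ is the class of $2m$ times differentiable functions $f$ on $[-l,l[$ with $f\in FD^{(0)}[-l,l[$ such that for each $0\le j\le 2m-1$ the series obtained by differentiating the Fourier series of $f^{(j)}$ term by term converges to $f^{(j+1)}$ at every point of $[-l,l[$. For $k\ge1$ put $\sigma_k=\sum_{n=0}^{m}(-1)^nA_{2n}\left(\frac{k\pi}{l}\right)^{2n}$ and $\omega_k=\sum_{n=0}^{m-1}(-1)^nA_{2n+1}\left(\frac{k\pi}{l}\right)^{2n+1}$.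 (The numbers $\sigma_k$ are distinct from the constant $\sigma$, and the numbers $\omega_k$ from the sample point $\omega$.) For $s\in\mathbb{R}$ and $f(x)=\frac{c_0}{2}+\sum_{k=1}^\infty \left(c_k\cos\frac{k\pi x}{l}+d_k\sin\frac{k\pi x}{l}\right)\in FD^{(0)}[-l,l[$, the function $e^{s\mathbb{A}}f$ is $$(e^{s\mathbb{A}}f)(x)=\frac{e^{sA_0}c_0}{2}+\sum_{k=1}^\infty e^{\sigma_k s}\Big((c_k\cos(\omega_k s)+d_k\sin(\omega_k s))\cos\tfrac{k\pi x}{l}+(d_k\cos(\omega_k s)-c_k\sin(\omega_k s))\sin\tfrac{k\pi x}{l}\Big),$$ defined whenever this series converges at every $x\in[-l,l[$. In particular $e^{s\mathbb{A}}I_{[-l,l[}=e^{sA_0}I_{[-l,l[}$. The estimator $T_n$ is understood on those sequences for which $e^{-t_0\mathbb{A}}$ is defined at $\frac1n\sum_{k=1}^n Z_k$; a sequence $(Z_k)$ for which some $T_n$ is undefined falls under the ''otherwise'' case in the definition of $T$. Regularity condition (R): writing $\theta(x)=\frac{c_0}{2}+\sum_{k\ge1}\left(c_k\cos\frac{k\pi x}{l}+d_k\sin\frac{k\pi x}{l}\right)$, the sequence $(\frac{c_0}{2},c_1,d_1,c_2,d_2,\dots)$ of real numbers is such that the series $$\frac{e^{tA_0}c_0}{2}+\sum_{k=1}^\infty e^{\sigma_k t}\Big((c_k\cos(\omega_k t)+d_k\sin(\omega_k t))\cos\tfrac{k\pi x}{l}+(d_k\cos(\omega_k t)-c_k\sin(\omega_k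 t))\sin\tfrac{k\pi x}{l}\Big)+\sigma\int_0^te^{(t-\tau)A_0}dW(\tau,\omega)\,I_{[-l,l[}(x)$$ belongs to the class $FD^{(2m)}[-l,l[$ as a series in the variable $x$ for all $t\ge0$, $\omega\in\Omega$, and is differentiable term by term as a series in the variable $t$ for all $x\in[-l,l[$, $\omega\in\Omega$. $\mu_\theta^{\mathbb{N}}$ denotes the countable product of copies of $\mu_\theta$ on $(\mathbb{C}[-l,l[)^{\mathbb{N}}$. *)

(* Defs.v *)
From HB Require Import structures.
From mathcomp Require Import all_boot all_order all_algebra.
From mathcomp Require Import all_classical all_reals all_analysis.

Set Implicit Arguments.
Unset Strict Implicit.
Unset Printing Implicit Defensive.

Import Order.TTheory GRing.Theory Num.Theory.
Import numFieldNormedType.Exports.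

Local Open Scope classical_set_scope.
Local Open Scope ring_scope.

(* The Banach space C[-l,l[ of bounded continuous real functions. A function
   on [-l,l[ is represented by its extension by 0 to the whole of R, so that
   two elements are equal as soon as they agree on [-l,l[. *)
Section bounded_continuous.
Context {R : realType} (l : R).

Definition BCpred : {pred R -> R} := mem [set f : R -> R |
  [/\ {within `[-l, l[, continuous f},
      exists M, forall x, `[-l, l[%classic x -> `|f x| <= M &
      forall x, ~ `[-l, l[%classic x -> f x = 0]].

Record BC := MkBC { BC_fun :> R -> R ; BC_prop : BC_fun \in BCpred }.

HB.instance Definition _ := [isSub for BC_fun].
HB.instance Definition _ := [Choice of BC by <:].

Lemma BCP (f : BC) : [/\ {within `[-l, l[, continuous f},
  exists M, forall x, `[-l, l[%classic x -> `|f x| <= M &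
  forall x, ~ `[-l, l[%classic x -> f x = 0].
Proof. by have := BC_prop f; rewrite inE. Qed.

Lemma BC_submod_closed : submod_closed BCpred.
Proof.
split.
  rewrite inE; split=> //; last by exists 0 => x _; rewrite normr0.
  by move=> x; exact: cvg_cst.
move=> a f g; rewrite !inE => -[cf [M fM] f0] [cg [N gN] g0]; split.
- move=> x; apply: cvgD; last exact: cg.
  by apply: cvgM; [exact: cvg_cst|exact: cf].
- exists (`|a| * M + N) => x lx; rewrite (le_trans (ler_normD _ _))// lerD//.
    by rewrite [X in `|X|]/GRing.scale/= normrM ler_wpM2l//; exact: fM.
  exact: gN.
- move=> x nx; rewrite -[LHS]/(a * f x + g x).
  by rewrite f0// g0// mulr0 addr0.
Qed.

HB.instance Definition _ :=
  GRing.isSubmodClosed.Build _ _ BCpred BC_submod_closed.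
HB.instance Definition _ := [SubChoice_isSubLmodule of BC by <:].

Lemma BC_addE (f g : BC) x : (f + g) x = f x + g x. Proof. by []. Qed.

Lemma BC_scaleE (a : R) (f : BC) x : (a *: f) x = a * f x. Proof. by []. Qed.

Definition supnorm (f : BC) : R := sup [set `|f x| | x in `[-l, l[%classic].

Lemma supnorm_ub (f : BC) x : `[-l, l[%classic x -> `|f x| <= supnorm f.
Proof.
move=> lx; apply: sup_ubound; last by exists x.
by have [_ [M fM] _] := BCP f; exists M => _ [y ly <-]; exact: fM.
Qed.

Lemma supnorm_le (f : BC) M : 0 <= M ->
  (forall x, `[-l, l[%classic x -> `|f x| <= M) -> supnorm f <= M.
Proof.
move=> M0 fM; rewrite /supnorm.
have [->|/set0P ne] := eqVneq [set `|f x| | x in `[-l, l[%classic] set0.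
  by rewrite sup0.
by apply: ge_sup => // _ [x lx <-]; exact: fM.
Qed.

Lemma supnorm_ge0 f : 0 <= supnorm f.
Proof.
rewrite /supnorm.
have [->|/set0P[_ [x lx _]]] := eqVneq [set `|f x| | x in `[-l, l[%classic] set0.
  by rewrite sup0.
exact: le_trans (normr_ge0 _) (supnorm_ub f lx).
Qed.

Lemma supnormD f g : supnorm (f + g) <= supnorm f + supnorm g.
Proof.
apply: supnorm_le => [|x lx]; first by rewrite addr_ge0// supnorm_ge0.
by rewrite BC_addE (le_trans (ler_normD _ _))// lerD// supnorm_ub.
Qed.

Lemma supnormZ a f : supnorm (a *: f) = `|a| * supnorm f.
Proof.
apply/eqP; rewrite eq_le; apply/andP; split.
  apply: supnorm_le => [|x lx]; first by rewrite mulr_ge0// supnorm_ge0.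
  by rewrite BC_scaleE normrM ler_wpM2l// supnorm_ub.
have [->|a0] := eqVneq a 0; first by rewrite normr0 mul0r supnorm_ge0.
rewrite -ler_pdivlMl ?normr_gt0//; apply: supnorm_le => [|x lx].
  by rewrite mulr_ge0 ?supnorm_ge0// invr_ge0.
rewrite ler_pdivlMl ?normr_gt0// -normrM -BC_scaleE; exact: supnorm_ub.
Qed.

Lemma supnorm_eq0 f : supnorm f = 0 -> f = 0.
Proof.
move=> f0; apply/val_inj/funext => x /=.
have [lx|nlx] := pselect (`[-l, l[%classic x).
  by apply/normr0_eq0/eqP; rewrite eq_le normr_ge0 andbT -f0 supnorm_ub.
by have [_ _ ->] := BCP f.
Qed.

HB.instance Definition _ :=
  Lmodule_isNormed.Build R BC supnormD supnormZ supnorm_eq0.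

Lemma BC_indic_subproof : (\1_(`[-l, l[%classic) : R -> R) \in BCpred.
Proof.
rewrite inE; split.
- apply: (@subspace_eq_continuous R `[-l, l[ R (cst 1)) => [x lx|x].
    by rewrite [RHS]indicE lx.
  exact: cvg_cst.
- by exists 1 => x lx; rewrite indicE mem_set// normr1.
- by move=> x nlx; rewrite indicE memNset.
Qed.

Definition BC_indic : BC := MkBC BC_indic_subproof.

(* C[-l,l[ with its Borel sigma-algebra, and the space of sequences
   with the product sigma-algebra. *)
Definition BCborel := g_sigma_algebraType (@open BC).

Definition BCseq := g_sigma_algebraType
  [set C : set (nat -> BC) | exists k (B : set BCborel),
     measurable B /\ C = [set Z | B (Z k)]].

End bounded_continuous.
Arguments BC {R} l.
Arguments BC_indic {R} l.
Arguments BCborel {R} l.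
Arguments BCseq {R} l.

Section trigonometric_series.
Context {R : realType} (l : R).

Definition fourier_cos (f : R -> R) (k : nat) : R :=
  l^-1 * (\int[lebesgue_measure]_(x in `[-l, l[) (f x * cos (k%:R * pi * x / l))).

Definition fourier_sin (f : R -> R) (k : nat) : R :=
  l^-1 * (\int[lebesgue_measure]_(x in `[-l, l[) (f x * sin (k%:R * pi * x / l))).

Definition trig_term (c d : nat -> R) (k : nat) (x : R) : R :=
  if k == 0%N then c 0%N / 2
  else c k * cos (k%:R * pi * x / l) + d k * sin (k%:R * pi * x / l).

Definition fourier_term (f : R -> R) : nat -> R -> R :=
  trig_term (fourier_cos f) (fourier_sin f).

(* Derivative at x relative to the set D (one-sided at an endpoint of D). *)
Definition is_derive_within (D : set R) (f : R -> R) (x a : R) : Prop :=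
  (fun y => (f y - f x) / (y - x)) @ within D x^' --> a.

Definition FD0 : set (BC l) := [set f |
  forall x, `[-l, l[%classic x ->
    series (fun k => fourier_term f k x) @ \oo --> f x].

(* g j is the j-th derivative of f on [-l,l[; its integrability gives a meaning
   to its Fourier series. *)
Definition FD (p : nat) : set (BC l) := [set f | FD0 f /\
  exists g : nat -> R -> R,
    (forall x, `[-l, l[%classic x -> g 0%N x = f x) /\
    forall j, (j < p)%N ->
      lebesgue_measure.-integrable `[-l, l[%classic (EFin \o g j) /\
      forall x, `[-l, l[%classic x ->
        is_derive_within `[-l, l[%classic (g j) x (g j.+1 x) /\
        series (fun k => derive1 (fourier_term (g j) k) x) @ \oo --> g j.+1 x].

End trigonometric_series.

Section semigroup.
Context {R : realType} (l : R) (m : nat) (A : nat -> R).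

Definition sigma_ (k : nat) : R :=
  \sum_(0 <= n < m.+1) (-1) ^+ n * A n.*2 * (k%:R * pi / l) ^+ n.*2.

Definition omega_ (k : nat) : R :=
  \sum_(0 <= n < m) (-1) ^+ n * A n.*2.+1 * (k%:R * pi / l) ^+ n.*2.+1.

(* As sigma_ 0 = A 0 and omega_ 0 = 0, the term of index 0 below is
   e^{s A_0} c_0 / 2. *)
Definition semigroup_term (s : R) (c d : nat -> R) : nat -> R -> R :=
  trig_term l
    (fun k => expR (sigma_ k * s) *
       (c k * cos (omega_ k * s) + d k * sin (omega_ k * s)))
    (fun k => expR (sigma_ k * s) *
       (d k * cos (omega_ k * s) - c k * sin (omega_ k * s))).

Definition is_semigroup (s : R) (f g : BC l) : Prop :=
  FD0 f /\ forall x, `[-l, l[%classic x ->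
    series (fun k => semigroup_term s (fourier_cos l f) (fourier_sin l f) k x)
      @ \oo --> g x.

(* e^{sA} f; the value is 0 when e^{sA} f is undefined. *)
Definition semigroup (s : R) (f : BC l) : BC l :=
  xget 0 [set g | is_semigroup s f g].

Definition semigroup_defined (s : R) (f : BC l) : Prop :=
  exists g, is_semigroup s f g.

Definition sample_mean (Z : nat -> BC l) (n : nat) : BC l :=
  n.+1%:R^-1 *: \sum_(k < n.+1) Z k.

(* Samples are numbered from 0: Z k stands for Z_{k+1}, and Tn n for T_{n+1}. *)
Definition Tn (t0 : R) (n : nat) (Z : nat -> BC l) : BC l :=
  semigroup (- t0) (sample_mean Z n).

Definition estimate (t0 : R) (theta_star : BC l) (Z : nat -> BC l) : BC l :=
  if `[< (forall n, semigroup_defined (- t0) (sample_mean Z n)) /\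
         cvgn (fun n => Tn t0 n Z) /\
         FD0 (limn (fun n => Tn t0 n Z)) >]
  then limn (fun n => Tn t0 n Z) else theta_star.

End semigroup.

Section wiener.
Context {R : realType} {d : measure_display} {Omega : measurableType d}.
Variable P : probability Omega R.
Variable W : R -> {RV P >-> R}.

Local Notation increment s t := (fun w : Omega => W t w - W s w).

Definition independent_increments : Prop :=
  forall (n : nat) (t : nat -> R) (B : nat -> set R),
    0 <= t 0%N -> (forall i, t i <= t i.+1) -> (forall i, measurable (B i)) ->
    P (\bigcap_(i in `I_n) (increment (t i) (t i.+1) @^-1` B i)) =
    (\prod_(i < n) P (increment (t i) (t i.+1) @^-1` B i))%E.

(* Only the times t >= 0 matter. *)
Definition wiener_process : Prop :=
  [/\ {ae P, forall w, W 0 w = 0},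
      independent_increments,
      forall (s t : R) (B : set R), 0 <= s -> s < t -> measurable B ->
        P (increment s t @^-1` B) = normal_prob 0 (Num.sqrt (t - s)) B &
      {ae P, forall w, {within `[0, +oo[, continuous (fun t => W t w)}}].

Definition step_fun (N : nat) (s a : nat -> R) (x : R) : R :=
  \sum_(i < N) a i * \1_(`[s i, s i.+1[%classic) x.

Definition step_integral (N : nat) (s a : nat -> R) (w : Omega) : R :=
  \sum_(i < N) a i * increment (s i) (s i.+1) w.

(* X is a version of the Ito (Wiener) integral of the deterministic function f
   over [0,t]: the L2(P)-limit of the integrals of step functions that converge
   to f in L2([0,t]). *)
Definition is_wiener_integral (f : R -> R) (t : R) (X : Omega -> R) : Prop :=
  exists (N : nat -> nat) (s a : nat -> nat -> R),
    [/\ forall n, [/\ s n 0%N = 0, s n (N n) = t & forall i, s n i <= s n i.+1],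
        (\int[lebesgue_measure]_(x in `[0%R, t])
           ((step_fun (N n) (s n) (a n) x - f x) ^+ 2)%:E)%E @[n --> \oo] --> 0%E &
        (\int[P]_w ((step_integral (N n) (s n) (a n) w - X w) ^+ 2)%:E)%E
          @[n --> \oo] --> 0%E].

End wiener.

Section signal_process.
Context {R : realType} {d : measure_display} {Omega : measurableType d}.
Context {P : probability Omega R}.
Variables (l : R) (m : nat) (A : nat -> R) (sigma : R).
(* J t w is the stochastic integral over [0,t] of exp((t - tau) A_0) dW. *)
Variable J : R -> {RV P >-> R}.

(* As e^{(t - tau)A} I = exp((t - tau) A_0) I, the stochastic integral of the
   C[-l,l[-valued integrand is J t w times I. *)
Definition xi (theta : BC l) (t : R) (w : Omega) : BCborel l :=
  semigroup m A t theta + (sigma * J t w) *: BC_indic l.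

Lemma measurable_xi theta t : measurable_fun setT (xi theta t).
Proof.
apply: (@measurability _ _ Omega (BCborel l) setT (xi theta t) (@open (BC l))).
  by [].
move=> _ [U oU <-]; rewrite setTI.
pose h (r : R) : BC l := semigroup m A t theta + (sigma * r) *: BC_indic l.
have ch : continuous h.
  move=> r; apply: cvgD; first exact: cvg_cst.
  by apply: cvgZr_tmp; apply: cvgM; [exact: cvg_cst|exact: cvg_id].
have mhU : measurable (h @^-1` U).
  by apply: measurable_realfun.open_measurable; apply: open_comp => // x _; exact: ch.
by have := measurable_funPTI (J t) mhU.
Qed.

HB.instance Definition _ theta t :=
  isMeasurableFun.Build _ _ _ _ (xi theta t) (measurable_xi theta t).

Definition mu_ (t0 : R) (theta : BC l) : probability (BCborel l) R :=
  distribution P (xi theta t0).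

(* Regularity condition on the signal. The stochastic term of the series does not depend on the
   summation index and is not differentiable in t, so differentiability
   term by term in t concerns the trigonometric series. *)
Definition regularity (theta : BC l) : Prop :=
  let u t := semigroup_term l m A t (fourier_cos l theta) (fourier_sin l theta) in
  (forall (t : R) (w : Omega), 0 <= t -> exists2 F : BC l, FD m.*2 F &
     forall x, `[-l, l[%classic x ->
       series (fun k => u t k x) n + sigma * J t w * BC_indic l x
         @[n --> \oo] --> F x) /\
  (forall x, `[-l, l[%classic x -> exists v v' : R -> R, forall t, 0 <= t ->
     [/\ series (fun k => u t k x) @ \oo --> v t,
         is_derive_within `[0, +oo[%classic v t (v' t) &
         series (fun k => derive1 (fun s => u s k x) t) @ \oo --> v' t]).

End signal_process.

(* M is the countable product of copies of mu; this determines M. *)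
Definition is_countable_product {R : realType} {l : R}
    (mu : probability (BCborel l) R) (M : probability (BCseq l) R) : Prop :=
  forall (n : nat) (B : nat -> set (BCborel l)), (forall k, measurable (B k)) ->
    M [set Z | forall k, (k < n)%N -> B k (Z k)] = (\prod_(k < n) mu (B k))%E.

(* Main.v *)
Require Import Defs.
From mathcomp Require Import all_boot all_order all_algebra.
From mathcomp Require Import all_classical all_reals all_analysis.
From mathcomp Require Import measurable_realfun.
From mathcomp Require Import ring lra zify.

Import Order.TTheory GRing.Theory Num.Theory.
Import numFieldNormedType.Exports.

Local Open Scope classical_set_scope.
Local Open Scope ring_scope.

(** Write I for the constant function 1 on [-l,l[ and g for e^{t0 A} theta. The
    noise only moves the signal along the line g + R I, so each observation is
    Z_k = g + a_k I, where the a_k are independent copies of sigma * J t0. The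
    semigroup acts on the Fourier coefficient of index k by a rotation of angle
    omega_k s and a dilation by exp(sigma_k s), and e^{-t0 A} undoes e^{t0 A}
    exactly; hence the estimator at a sample of mean g + r I is
    theta + exp(- t0 A_0) r I, and consistency is the strong law of large numbers
    for the a_k.

    The delicate point is that e^{-t0 A} sees the function g only through its
    Fourier integrals, whereas g is given as the pointwise sum of a
    trigonometric series. That its coefficients are the Fourier coefficients
    of g would follow from the uniqueness theory of trigonometric series; here
    the regularity condition gives it more cheaply. Let rho_k = c_k^2 + d_k^2.
    At t = 0 the series of theta can be differentiated once, so
    k c_k and k d_k are bounded by the Cantor-Lebesgue theorem
    (cantor_lebesgue); at time 4 t0 the series still converges, so
    exp(8 sigma_k t0) rho_k is bounded as well. Interpolating,
    exp(2 sigma_k t0) rho_k = O(k^{-3/2}), which is summable whatever the sign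
    of sigma_k (regularity_summable). A trigonometric series with
    square-summable coefficients that converges pointwise to a bounded function
    is the Fourier series of that function (fourier_of_trig_series): by Fatou's
    lemma and orthogonality its partial sums also converge in L^2.

    For the probabilistic half, the Wiener integral J t0 is an L^2 limit of
    linear combinations of centred Gaussian increments, so it is square
    integrable with mean 0 (wiener_integral_centered_L2). The strong law
    (slln_orthogonal) only uses that the a_k are orthogonal and
    bounded in L^2: along the squares n^2 the second moments of the means are
    summable, and so are those of the oscillations between consecutive squares.
    Being equal to theta is thus an almost sure property of T, and an almost
    sure property is measurable for the completed product measure
    (ae_completed). *)

(** * Sums of orthogonal functions *)

Section pythagoras.
Context d (T : measurableType d) (R : realType) (mu : {measure set T -> \bar R}).
Variables (D : set T) (mD : measurable D).

Lemma integrableZ_EFin (c : R) (f : T -> R) : mu.-integrable D (EFin \o f) ->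
  mu.-integrable D (EFin \o (fun x => c * f x)).
Proof. exact: integrableZl. Qed.

Lemma integrableD_EFin (f g : T -> R) : mu.-integrable D (EFin \o f) ->
  mu.-integrable D (EFin \o g) -> mu.-integrable D (EFin \o (fun x => f x + g x)).
Proof. exact: integrableD. Qed.

Lemma integrableB_EFin (f g : T -> R) : mu.-integrable D (EFin \o f) ->
  mu.-integrable D (EFin \o g) -> mu.-integrable D (EFin \o (fun x => f x - g x)).
Proof. exact: integrableB. Qed.

Lemma integrable_fsum (r : seq nat) (h : nat -> T -> R) :
  (forall k, mu.-integrable D (EFin \o h k)) ->
  mu.-integrable D (EFin \o (fun x => \sum_(k <- r) h k x)).
Proof.
move=> ih; apply: (eq_integrable mD (fun x => \sum_(k <- r) (h k x)%:E)%E).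
  by move=> x _; rewrite sumEFin.
by apply: integrable_sum => // i _; exact: ih.
Qed.

Lemma Rintegral_fsum (r : seq nat) (h : nat -> T -> R) :
  (forall k, mu.-integrable D (EFin \o h k)) ->
  (\int[mu]_(x in D) (\sum_(k <- r) h k x) =
   \sum_(k <- r) \int[mu]_(x in D) h k x).
Proof.
move=> ih; elim: r => [|a r IH].
  under eq_Rintegral do rewrite big_nil.
  by rewrite big_nil Rintegral_cst// mul0r.
under eq_Rintegral do rewrite big_cons.
by rewrite big_cons RintegralD ?IH//; exact: integrable_fsum.
Qed.

Variable f : nat -> T -> R.
Hypothesis intf : forall i j, mu.-integrable D (EFin \o (fun x => f i x * f j x)).
Hypothesis orthf : forall i j, i != j -> \int[mu]_(x in D) (f i x * f j x) = 0.

Lemma integrable_sum_sqr (r : seq nat) : mu.-integrable D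
  (EFin \o (fun x => (\sum_(k <- r) f k x) ^+ 2)).
Proof.
apply: (eq_integrable mD
  (EFin \o (fun x => \sum_(k <- r) \sum_(j <- r) f k x * f j x))).
  by move=> x _ /=; rewrite expr2 big_distrlr.
apply: integrable_fsum => k.
exact: (@integrable_fsum r (fun j x => f k x * f j x)).
Qed.

(** Pythagoras: the off-diagonal terms of the expanded square vanish. *)
Lemma Rintegral_sum_sqr (r : seq nat) : uniq r ->
  \int[mu]_(x in D) ((\sum_(k <- r) f k x) ^+ 2) =
  \sum_(k <- r) \int[mu]_(x in D) (f k x * f k x).
Proof.
move=> ur.
under eq_Rintegral do rewrite expr2 big_distrlr/=.
rewrite (@Rintegral_fsum r (fun k x => \sum_(j <- r) f k x * f j x)); last first.
  by move=> k; exact: (@integrable_fsum r (fun j x => f k x * f j x)).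
apply: eq_big_seq => k kr.
rewrite (@Rintegral_fsum r (fun j x => f k x * f j x))//.
rewrite (bigD1_seq k)//= big1 ?addr0// => j jk.
by rewrite orthf// eq_sym.
Qed.

End pythagoras.

(** * Trigonometric functions on [-l,l[ *)

Section trigonometric_waves.
Context {R : realType}.
Implicit Types a b w x : R.

(** The coefficients are parameters, rather than separate sines and cosines, because
    the product of two waves and the derivative of a wave are again made of waves. *)
Definition wave a b w x : R := a * cos (w * x) + b * sin (w * x).

Lemma is_derive_wave a b w x :
  is_derive x 1 (wave a b w) (w * wave b (- a) w x).
Proof.
have dw : is_derive x 1 (fun x => w * x) w.
  apply: is_derive_eq; rewrite /GRing.scale/=; ring.
have dc : is_derive x 1 (fun x => cos (w * x)) (- sin (w * x) * w).
  exact: is_derive1_comp.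
have ds : is_derive x 1 (fun x => sin (w * x)) (cos (w * x) * w).
  exact: is_derive1_comp.
rewrite /wave; apply: is_derive_eq.
by rewrite /GRing.scale/=; ring.
Qed.

Lemma continuous_wave a b w : continuous (wave a b w).
Proof.
move=> x; apply: differentiable_continuous; apply/derivable1_diffP.
by have [] := is_derive_wave a b w x.
Qed.

(** Product-to-sum: all integrals of products reduce to integrals of single waves. *)
Lemma waveM a b a' b' w w' x : wave a b w x * wave a' b' w' x =
  wave ((a * a' - b * b') / 2) ((a * b' + b * a') / 2) (w + w') x +
  wave ((a * a' + b * b') / 2) ((b * a' - a * b') / 2) (w - w') x.
Proof.
by rewrite /wave [(w + w') * x]mulrDl [(w - w') * x]mulrBl cosD cosB sinD sinB; field.
Qed.

Lemma wave_sqr_le a b w x : wave a b w x ^+ 2 <= a ^+ 2 + b ^+ 2.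
Proof.
rewrite /wave -[leRHS]mulr1 -(cos2Dsin2 (w * x)) -subr_ge0.
set c := cos _; set s := sin _.
by rewrite (_ : _ - _ = (a * s - b * c) ^+ 2) ?sqr_ge0//; ring.
Qed.

End trigonometric_waves.

Section orthogonality.
Context {R : realType} (l : R).
Hypothesis l0 : 0 < l.
Local Notation mu := (@lebesgue_measure R).
Implicit Types a b w x : R.

Definition freq (n : nat) : R := n%:R * pi / l.

Lemma itv_measure : mu `[- l, l[%classic = (2 * l)%:E.
Proof.
have Nll : - l < l by rewrite gtrN.
by rewrite lebesgue_measure_itv/= lte_fin Nll -EFinB; congr EFin; ring.
Qed.

Lemma continuous_integrable_itv (f : R -> R) : continuous f ->
  mu.-integrable `[- l, l[%classic (EFin \o f).
Proof.
move=> cf; apply: (@integrableS _ _ _ mu `[- l, l]%classic) => //.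
  by apply: subset_itvl; rewrite bnd_simp.
apply: continuous_compact_integrable; first exact: segment_compact.
exact: continuous_subspaceT.
Qed.

Lemma sin_natpi n : sin (n%:R * pi) = 0 :> R.
Proof.
elim: n => [|n IH]; first by rewrite mul0r sin0.
by rewrite -natr1 mulrDl mul1r sinDpi IH oppr0.
Qed.

(** The primitive of a wave of positive frequency is again a wave, and a period
    of it fits a whole number of times in [-l,l[. *)
Lemma Rintegral_wave a b n : (0 < n)%N ->
  \int[mu]_(x in `[- l, l[) wave a b (freq n) x = 0.
Proof.
move=> n0; set w := freq n.
have w0 : w != 0.
  by rewrite !mulf_neq0 ?invr_neq0 ?pnatr_eq0 -?lt0n ?gt_eqF ?pi_gt0.
rewrite Rintegral_itv_bndo_bndc; last exact/continuous_integrable_itv/continuous_wave.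
pose F := wave (- b / w) (a / w) w.
have cF := @continuous_wave R (- b / w) (a / w) w.
rewrite /Rintegral (@continuous_FTC2 _ _ F).
- have wl : sin (w * l) = 0.
    by rewrite /w /freq divfK ?gt_eqF// sin_natpi.
  by rewrite /F /wave mulrN cosN sinN wl oppr0 -EFinB/= subrr.
- by rewrite gtrN.
- exact/continuous_subspaceT/continuous_wave.
- split; first by move=> x _; have [] := is_derive_wave (- b / w) (a / w) w x.
    by apply: cvg_at_right_filter; exact: cF.
  by apply: cvg_at_left_filter; exact: cF.
- move=> x _; rewrite derive1E.
  have [_ ->] := is_derive_wave (- b / w) (a / w) w x.
  by rewrite /wave; field.
Qed.

Lemma Rintegral_cst_itv a : \int[mu]_(x in `[- l, l[) a = 2 * l * a.
Proof.
rewrite Rintegral_cst// mulrC; congr (_ * _).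
by rewrite -[RHS]/(fine (2 * l)%:E) -itv_measure.
Qed.

Lemma integrable_waveM a b a' b' w w' : mu.-integrable `[- l, l[%classic
  (EFin \o (fun x => wave a b w x * wave a' b' w' x)).
Proof.
apply: continuous_integrable_itv => x.
by apply: cvgM; exact: continuous_wave.
Qed.

Lemma Rintegral_waveM a b a' b' w w' :
  \int[mu]_(x in `[- l, l[) (wave a b w x * wave a' b' w' x) =
  \int[mu]_(x in `[- l, l[)
    wave ((a * a' - b * b') / 2) ((a * b' + b * a') / 2) (w + w') x +
  \int[mu]_(x in `[- l, l[)
    wave ((a * a' + b * b') / 2) ((b * a' - a * b') / 2) (w - w') x.
Proof.
under eq_Rintegral do rewrite waveM.
by rewrite RintegralD//; exact/continuous_integrable_itv/continuous_wave.
Qed.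

Lemma Rintegral_wave_orthogonal a b a' b' j k : j != k ->
  \int[mu]_(x in `[- l, l[) (wave a b (freq j) x * wave a' b' (freq k) x) = 0.
Proof.
wlog kj : a b a' b' j k / (k < j)%N => [H|] jk.
  have [kj|jk'|/eqP] := ltngtP k j; first exact: H.
    under eq_Rintegral do rewrite mulrC.
    by rewrite H// eq_sym.
  by rewrite eq_sym (negbTE jk).
rewrite Rintegral_waveM.
rewrite (_ : freq j + freq k = freq (j + k)); last first.
  by rewrite /freq natrD; field; rewrite gt_eqF.
rewrite (_ : freq j - freq k = freq (j - k)); last first.
  by rewrite /freq natrB 1?ltnW//; field; rewrite gt_eqF.
by rewrite !Rintegral_wave ?addr0// ?subn_gt0// addn_gt0 (leq_ltn_trans _ kj).
Qed.

Lemma Rintegral_waveM_same a b a' b' k : (0 < k)%N ->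
  \int[mu]_(x in `[- l, l[) (wave a b (freq k) x * wave a' b' (freq k) x) =
  l * (a * a' + b * b').
Proof.
move=> k0; rewrite Rintegral_waveM.
rewrite (_ : freq k + freq k = freq (k + k)); last first.
  by rewrite /freq natrD; field; rewrite gt_eqF.
rewrite Rintegral_wave ?addn_gt0 ?k0// add0r subrr.
under eq_Rintegral do rewrite /wave mul0r cos0 sin0 mulr0 mulr1 addr0.
by rewrite Rintegral_cst_itv; field.
Qed.

Lemma Rintegral_waveM0 a b a' b' :
  \int[mu]_(x in `[- l, l[) (wave a b (freq 0) x * wave a' b' (freq 0) x) =
  2 * l * (a * a').
Proof.
under eq_Rintegral do rewrite /wave /freq !mul0r cos0 sin0 !mulr0 !mulr1 !addr0.
by rewrite Rintegral_cst_itv.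
Qed.

End orthogonality.

(** * The Cantor-Lebesgue theorem *)

Section cantor_lebesgue.
Context {R : realType} (l : R).
Hypothesis l0 : 0 < l.
Local Notation mu := (@lebesgue_measure R).
Local Notation I := `[- l, l[%classic.

Lemma bounded_integrable_itv (f : R -> R) (M : R) : measurable_fun I f ->
  (forall x, I x -> `|f x| <= M) -> mu.-integrable I (EFin \o f).
Proof.
move=> mf fM; apply: measurable_bounded_integrable => //.
  by apply: le_lt_trans (ltry (2 * l)); rewrite -(itv_measure l l0).
exists M; split; first exact: num_real.
by move=> x Mx y Iy; exact: le_trans (fM _ Iy) (ltW Mx).
Qed.

(** If the terms of a trigonometric series tend to 0 pointwise, its coefficients
    stay bounded. Let rho_k = a_k^2 + b_k^2. The squares of the terms, divided by
    1 + rho_k, are at most 1 and tend to 0, so by dominated convergence their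
    integrals l rho_k / (1 + rho_k) tend to 0. *)
Lemma cantor_lebesgue (a b : nat -> R) :
  (forall x, I x -> wave (a k) (b k) (freq l k) x @[k --> \oo] --> 0) ->
  \forall k \near \oo, a k ^+ 2 + b k ^+ 2 <= 1.
Proof.
move=> ab0; pose rho k := a k ^+ 2 + b k ^+ 2.
have rho_ge0 k : 0 <= rho k by rewrite addr_ge0// sqr_ge0.
have rho1 k : 0 < 1 + rho k by rewrite ltr_pwDl.
pose h k x := (1 + rho k)^-1 * wave (a k) (b k) (freq l k) x ^+ 2.
have h_ge0 k x : 0 <= h k x by rewrite mulr_ge0 ?sqr_ge0// invr_ge0 ltW.
have h_le k x : h k x <= wave (a k) (b k) (freq l k) x ^+ 2.
  by rewrite ler_piMl ?sqr_ge0// invf_le1// lerDl.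
have ch k : continuous (h k).
  move=> x; apply: cvgM; first exact: cvg_cst.
  by apply: (@cvgM _ _ _ _ (wave (a k) (b k) (freq l k))); exact: continuous_wave.
have mh k : measurable_fun I (h k).
  by apply: measurable_funTS; apply: continuous_measurable_fun; exact: ch.
have inth : (\int[mu]_(x in I) (h k x)%:E)%E @[k --> \oo] --> (0 : \bar R).
  have [|||||_ _] := @dominated_convergence _ _ R mu I (measurable_itv _)
    (fun k x => (h k x)%:E) (cst 0%E) (EFin \o cst 1).
  - by move=> k; apply/measurable_EFinP; exact: mh.
  - exact: measurable_cst.
  - apply: aeW => x Ix; apply: cvg_EFin; first exact: nearW.
    apply: (@squeeze_cvgr _ _ _ _ (cst 0) (fun k => wave (a k) (b k) (freq l k) x ^+ 2)).
    + by apply: nearW => k; rewrite /= h_ge0 h_le.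
    + exact: cvg_cst.
    + rewrite -[X in _ --> X](mulr0 (0 : R)).
      by apply: cvgM; exact: ab0.
  - apply: (@bounded_integrable_itv (cst 1) 1) => // x _.
    by rewrite /= normr1.
  - apply: aeW => x k _; rewrite /= lee_fin ger0_norm//.
    by rewrite ler_pdivrMl// mulr1 (le_trans (wave_sqr_le _ _ _ _))// lerDr.
  by rewrite integral0.
have hE k : (0 < k)%N ->
    (\int[mu]_(x in I) (h k x)%:E)%E = (l * (rho k / (1 + rho k)))%:E.
  move=> k0; rewrite -[LHS]fineK; last first.
    by apply: integrable_fin_num => //; exact: continuous_integrable_itv.
  congr EFin; rewrite -/(Rintegral mu I (h k)).
  rewrite RintegralZl//; last first.
    by apply: continuous_integrable_itv => // x;
      apply: (@cvgM _ _ _ _ (wave (a k) (b k) (freq l k))); exact: continuous_wave.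
  by rewrite Rintegral_waveM_same// -!expr2 -/(rho k); field; rewrite gt_eqF.
have : \forall k \near \oo, ((\int[mu]_(x in I) (h k x)%:E)%E < (l / 2)%:E)%E.
  move/fine_cvgP : inth => [finh /cvgrPdist_lt/(_ (l / 2))].
  rewrite divr_gt0// => /(_ isT) hl2.
  near=> k; rewrite -[X in (X < _)%E]fineK; last by near: k.
  rewrite lte_fin (le_lt_trans (ler_norm _))// -normrN -sub0r.
  by near: k.
move=> hl2; near=> k; rewrite -/(rho k).
have : ((l * (rho k / (1 + rho k)))%:E < (l / 2)%:E)%E.
  rewrite -hE; last by near: k; exists 1%N.
  by near: k.
rewrite lte_fin ltr_pM2l// ltr_pdivrMr//.
move: (rho k) => r; lra.
Unshelve. all: by end_near. Qed.
End cantor_lebesgue.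

(** * Square-summable trigonometric series are Fourier series *)

Section square_integrals.
Context {R : realType} (l : R).
Hypothesis l0 : 0 < l.
Local Notation mu := (@lebesgue_measure R).
Local Notation I := `[- l, l[%classic.

(** The constant term of a Fourier series is c_0 / 2: this correction lets the
    term of index 0 be treated as a wave like the others. *)
Definition half0 (c : nat -> R) (k : nat) : R := if k == 0%N then c 0%N / 2 else c k.

Lemma trig_termE (c d : nat -> R) k x :
  trig_term l c d k x = wave (half0 c k) (d k) (freq l k) x.
Proof.
rewrite /trig_term /half0 /wave /freq; case: eqP => [->|_].
  by rewrite !mul0r cos0 sin0 mulr0 mulr1 addr0.
by rewrite mulrAC.
Qed.

(** Needed for squared remainders, which have no evident dominating function. *)
Lemma fatou_bound (f : nat -> R -> R) (g : R -> R) (C : R) :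
  (forall n, measurable_fun I (f n)) -> (forall n x, 0 <= f n x) ->
  (forall x, I x -> f n x @[n --> \oo] --> g x) ->
  (forall n, (\int[mu]_(x in I) (f n x)%:E <= C%:E)%E) ->
  (\int[mu]_(x in I) (g x)%:E <= C%:E)%E.
Proof.
move=> mf f0 fg fC.
have -> : (\int[mu]_(x in I) (g x)%:E =
    \int[mu]_(x in I) limn_einf (fun n => (f n x)%:E))%E.
  apply: eq_integral => x; rewrite inE => Ix.
  have cf : (f n x)%:E @[n --> \oo] --> (g x)%:E.
    by apply: cvg_EFin; [exact: nearW|exact: fg].
  by rewrite is_cvg_limn_einfE; [exact/esym/cvg_lim|apply/cvg_ex; exists (g x)%:E].
apply: (le_trans (@fatou _ _ _ mu I _ (fun n x => (f n x)%:E) _ _)) => //.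
- by move=> n; apply/measurable_EFinP; exact: mf.
- by move=> n x _; rewrite lee_fin.
rewrite limn_einf_lim; apply: lime_le.
  exact: is_cvg_einfs.
apply: nearW => n; apply: le_trans (fC n).
by apply: ereal_inf_lbound; exists n => /=.
Qed.

Lemma Rintegral_wave_sum_sqr (a b : nat -> R) (m n : nat) : (0 < m)%N ->
  \int[mu]_(x in I) ((\sum_(m <= k < n) wave (a k) (b k) (freq l k) x) ^+ 2) =
  l * \sum_(m <= k < n) (a k ^+ 2 + b k ^+ 2).
Proof.
move=> m0; rewrite (@Rintegral_sum_sqr _ _ _ mu I _ (fun k =>
  wave (a k) (b k) (freq l k)))//.
- rewrite mulr_sumr; apply: eq_big_nat => k /andP[mk _].
  by rewrite Rintegral_waveM_same ?(leq_trans m0 mk)// !expr2.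
- by move=> i j; exact: integrable_waveM.
- by move=> i j ij; exact: Rintegral_wave_orthogonal.
- exact: iota_uniq.
Qed.

(** A form of the Cauchy-Schwarz inequality, from |h| <= e + h^2 / e. *)
Lemma Rintegral_abs_le (h v : R -> R) (e : R) : 0 < e ->
  mu.-integrable I (EFin \o h) ->
  mu.-integrable I (EFin \o (fun x => h x * v x)) ->
  mu.-integrable I (EFin \o (fun x => h x ^+ 2)) ->
  (forall x, `|v x| <= 1) ->
  \int[mu]_(x in I) (h x ^+ 2) <= l * e ^+ 2 ->
  `|\int[mu]_(x in I) (h x * v x)| <= 3 * l * e.
Proof.
move=> e0 ih ihv ih2 v1 hle.
apply: (@le_trans _ _ (\int[mu]_(x in I) `|h x * v x|)).
  exact: le_normr_Rintegral.
have i2 : mu.-integrable I (EFin \o (fun x => e^-1 * h x ^+ 2)).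
  exact: integrableZ_EFin.
have ie : mu.-integrable I (EFin \o cst e).
  by apply: continuous_integrable_itv => // x; exact: cvg_cst.
apply: (@le_trans _ _ (\int[mu]_(x in I) (e + e^-1 * h x ^+ 2))).
  apply: le_Rintegral => //.
  - exact: integrable_norm.
  - exact: integrableD_EFin.
  move=> x _; rewrite normrM.
  apply: (@le_trans _ _ `|h x|); first by rewrite ler_piMr.
  rewrite -[h x ^+ 2]real_normK ?num_real//.
  (* r <= e + r^2 / e, whether r <= e or e < r *)
  move: `|h x| (normr_ge0 (h x)) => r r0.
  have [re|er] := leP r e.
    by rewrite (le_trans re)// lerDl mulr_ge0 ?invr_ge0 ?sqr_ge0// ltW.
  apply: (@le_trans _ _ (e^-1 * r ^+ 2)); last by rewrite lerDr ltW.
  by rewrite ler_pdivlMl// expr2 ler_pM2r ?(lt_trans e0 er)// ltW.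
rewrite RintegralD// (Rintegral_cst_itv _ l0) RintegralZl//.
apply: (@le_trans _ _ (2 * l * e + e^-1 * (l * e ^+ 2))).
  by rewrite lerD2l ler_pM2l// invr_gt0.
rewrite le_eqVlt; apply/orP; left; apply/eqP; field.
by rewrite gt_eqF.
Qed.

End square_integrals.

Section trigonometric_series.
Context {R : realType} (l : R).
Hypothesis l0 : 0 < l.
Local Notation mu := (@lebesgue_measure R).
Local Notation I := `[- l, l[%classic.

Lemma continuous_wave_sum (a b w : nat -> R) (r : seq nat) :
  continuous (fun x => \sum_(k <- r) wave (a k) (b k) (w k) x).
Proof.
elim: r => [|k r IH] x.
  under eq_fun do rewrite big_nil.
  exact: cvg_cst.
under eq_fun do rewrite big_cons.
by apply: cvgD; [exact: continuous_wave|exact: IH].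
Qed.

(** The partial sums S_n converge pointwise to G, and for n <= N the integral of
    (S_N - S_n)^2 is l times a slice of the convergent series of the
    c_k^2 + d_k^2. Fatou turns this into a bound on the integral of (G - S_n)^2, so
    that integrating S_n or G against a wave makes no difference in the limit. *)
Lemma Rintegral_trig_series (c d : nat -> R) (G : R -> R) (M C p q : R) (j : nat) :
  measurable_fun I G -> (forall x, I x -> `|G x| <= M) ->
  (forall n, \sum_(1 <= k < n) (c k ^+ 2 + d k ^+ 2) <= C) ->
  (forall x, I x -> series (fun k => trig_term l c d k x) @ \oo --> G x) ->
  p ^+ 2 + q ^+ 2 <= 1 ->
  \int[mu]_(x in I) (G x * wave p q (freq l j) x) =
  \int[mu]_(x in I) (wave (half0 c j) (d j) (freq l j) x * wave p q (freq l j) x).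
Proof.
move=> mG GM sC cG pq.
pose u k := wave (half0 c k) (d k) (freq l k).
pose v := wave p q (freq l j).
pose s := fun n => \sum_(1 <= k < n) (c k ^+ 2 + d k ^+ 2).
pose S n x := \sum_(0 <= k < n) u k x.
have v1 x : `|v x| <= 1.
  rewrite -(ler_pXn2r (n := 2))// ?nnegrE// expr1n real_normK ?num_real//.
  exact: le_trans (wave_sqr_le _ _ _ _) pq.
have nds : nondecreasing_seq s.
  apply/nondecreasing_seqP => -[|n]; first by rewrite /s !big_geq.
  by rewrite /s [leRHS]big_nat_recr//= lerDl addr_ge0// sqr_ge0.
have cs : cvgn s.
  by apply: nondecreasing_is_cvgn => //; exists C => _ [n _ <-]; exact: sC.
have cSG x : I x -> S^~ x @ \oo --> G x.
  move=> Ix; have := cG x Ix; rewrite (_ : series _ = S^~ x)//.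
  by apply/funext => n; apply: eq_bigr => k _; rewrite trig_termE.
have tail (e : R) : 0 < e -> exists n, [/\ (0 < n)%N, (j < n)%N &
    forall N, s N - s n <= e ^+ 2].
  move=> e0; have /cvgrPdist_le/(_ (e ^+ 2)) := cs.
  rewrite exprn_gt0// => /(_ isT)[n0 _ H].
  exists (maxn n0 j.+1); split; rewrite ?leq_max ?ltnS ?leqnn ?orbT//.
  move=> N; apply: le_trans (H (maxn n0 j.+1) _); last by rewrite /= leq_maxl.
  rewrite (le_trans _ (ler_norm _))// lerD2r.
  exact: nondecreasing_cvgn_le.
have intu i k : mu.-integrable I (EFin \o (fun x => u i x * u k x)).
  exact: integrable_waveM.
have key (e : R) : 0 < e ->
    `|\int[mu]_(x in I) (G x * v x) - \int[mu]_(x in I) (u j x * v x)| <= 3 * l * e.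
  move=> e0; have [n [n0 jn sn]] := tail e e0.
  pose h x := G x - S n x.
  have cS k : continuous (S k) by exact: continuous_wave_sum.
  have mS k : measurable_fun I (S k).
    by apply: measurable_funTS; apply: continuous_measurable_fun; exact: cS.
  have iG : mu.-integrable I (EFin \o G) by exact: bounded_integrable_itv GM.
  have iS : mu.-integrable I (EFin \o S n) by exact: continuous_integrable_itv.
  have ih : mu.-integrable I (EFin \o h) by exact: integrableB_EFin.
  have iGv : mu.-integrable I (EFin \o (fun x => G x * v x)).
    apply: (@bounded_integrable_itv _ _ l0 _ M).
      apply: measurable_funM => //; apply: measurable_funTS.
      by apply: continuous_measurable_fun; exact: continuous_wave.
    move=> x Ix; rewrite normrM (le_trans _ (GM x Ix))// ler_piMr//.
  have iSv : mu.-integrable I (EFin \o (fun x => S n x * v x)).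
    apply: continuous_integrable_itv => // x; apply: cvgM; first exact: cS.
    exact: continuous_wave.
  have ihv : mu.-integrable I (EFin \o (fun x => h x * v x)).
    rewrite (_ : (fun x => h x * v x) = (fun x => G x * v x - S n x * v x)).
      exact: integrableB_EFin.
    by apply/funext => x; rewrite mulrBl.
  have h2le : (\int[mu]_(x in I) (h x ^+ 2)%:E <= (l * e ^+ 2)%:E)%E.
    apply: (@fatou_bound _ _ (fun N x => (\sum_(n <= k < n + N) u k x) ^+ 2)).
    - move=> N; apply: measurable_funX; apply: measurable_funTS.
      by apply: continuous_measurable_fun; exact: continuous_wave_sum.
    - by move=> N x; exact: sqr_ge0.
    - move=> x Ix; have cx : \sum_(n <= k < n + N) u k x @[N --> \oo] --> h x.
        rewrite (_ : (fun N => _) = (fun N => S (N + n)%N x - S n x)); last first.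
          apply/funext => N; rewrite addnC /S.
          rewrite [X in _ = X - _](@big_cat_nat _ _ _ n)//= ?leq_addl//.
          by rewrite addrAC subrr add0r.
        apply: cvgB; last exact: cvg_cst.
        by apply: (cvg_comp _ (S^~ x) (cvg_addnr n)); exact: cSG.
      exact: cvgM.
    - move=> N; rewrite -[leLHS]fineK; last first.
        apply: integrable_fin_num => //.
        exact: (@integrable_sum_sqr _ _ _ mu I _ u).
      rewrite lee_fin -/(Rintegral _ _ _).
      rewrite (@Rintegral_wave_sum_sqr _ l l0 (half0 c) d)//.
      rewrite ler_pM2l// (le_trans _ (sn (n + N)%N))//.
      rewrite /s [X in _ <= X - _](@big_cat_nat _ _ _ n)//= ?leq_addr//.
      rewrite addrAC subrr add0r le_eqVlt; apply/orP; left; apply/eqP.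
      apply: eq_big_nat => k /andP[nk _].
      by rewrite /half0 gtn_eqF// (leq_trans n0).
  have ih2 : mu.-integrable I (EFin \o (fun x => h x ^+ 2)).
    apply/integrableP; split.
      apply/measurable_EFinP; apply: measurable_funX.
      by apply: measurable_funB; [exact: mG|exact: mS].
    under eq_integral do rewrite /= ger0_norm ?sqr_ge0//.
    exact: le_lt_trans h2le (ltry _).
  rewrite (_ : \int[mu]_(x in I) (u j x * v x) =
    \int[mu]_(x in I) (S n x * v x)); last first.
    under [RHS]eq_Rintegral do rewrite mulr_suml.
    rewrite (@Rintegral_fsum _ _ _ mu I _ _ (fun k x => u k x * v x))//; last first.
      by move=> k; exact: integrable_waveM.
    rewrite (bigD1_seq j)/= ?mem_index_iota ?iota_uniq//.
    rewrite big1 ?addr0// => k kj; exact: Rintegral_wave_orthogonal.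
  rewrite -RintegralB//.
  under eq_Rintegral do rewrite -mulrBl.
  apply: Rintegral_abs_le => //.
  rewrite -lee_fin /Rintegral fineK//.
  exact: integrable_fin_num.
apply/eqP; rewrite -subr_eq0 -normr_eq0 eq_le normr_ge0 andbT.
apply/ler_addgt0Pl => e e0; rewrite addr0.
have := key (e / (3 * l)); rewrite divr_gt0 ?mulr_gt0// => /(_ isT).
by rewrite [X in _ <= X]mulrC divfK// gt_eqF// mulr_gt0.
Qed.

End trigonometric_series.

Section uniqueness.
Context {R : realType} (l : R).
Hypothesis l0 : 0 < l.
Local Notation mu := (@lebesgue_measure R).
Local Notation I := `[- l, l[%classic.
Implicit Types (f : BC l) (c d : nat -> R).

Lemma measurable_BC f : measurable_fun I f.
Proof.
have [cf _ _] := BCP f.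
exact: subspace_continuous_measurable_fun.
Qed.

Lemma bounded_BC f : exists M, forall x, I x -> `|f x| <= M.
Proof. by have [_ + _] := BCP f. Qed.

Lemma fourier_cosE (f : R -> R) k : fourier_cos l f k =
  l^-1 * \int[mu]_(x in I) (f x * wave 1 0 (freq l k) x).
Proof.
congr (_ * _); apply: eq_Rintegral => x _.
by rewrite /wave mul1r mul0r addr0 /freq mulrAC.
Qed.

Lemma fourier_sinE (f : R -> R) k : fourier_sin l f k =
  l^-1 * \int[mu]_(x in I) (f x * wave 0 1 (freq l k) x).
Proof.
congr (_ * _); apply: eq_Rintegral => x _.
by rewrite /wave mul1r mul0r add0r /freq mulrAC.
Qed.

Lemma eq_trig_term c d c' d' k x : c k = c' k ->
  ((0 < k)%N -> d k = d' k) -> trig_term l c d k x = trig_term l c' d' k x.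
Proof.
rewrite /trig_term; case: eqP => [-> ->//|/eqP]; rewrite -lt0n.
by move=> k0 -> ->.
Qed.

(** Integrating against the cosine or the sine of one frequency isolates one
    coefficient, by orthogonality. *)
Lemma fourier_of_trig_series c d f (C : R) :
  (forall n, \sum_(1 <= k < n) (c k ^+ 2 + d k ^+ 2) <= C) ->
  (forall x, I x -> series (fun k => trig_term l c d k x) @ \oo --> f x) ->
  (forall k, fourier_cos l f k = c k) /\
  (forall k, (0 < k)%N -> fourier_sin l f k = d k).
Proof.
move=> sC cf; have [M fM] := bounded_BC f.
have E p q j := @Rintegral_trig_series R l l0 c d f M C p q j
  (measurable_BC f) fM sC cf.
split=> k.
  rewrite fourier_cosE E; last by rewrite expr1n expr0n addr0.
  have [->|k0] := posnP k.
    by rewrite Rintegral_waveM0// /half0/= mulr1; field; rewrite gt_eqF.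
  rewrite Rintegral_waveM_same// /half0 gtn_eqF// mulr1 mulr0 addr0.
  by rewrite mulKf// gt_eqF.
move=> k0; rewrite fourier_sinE E; last by rewrite expr1n expr0n add0r.
rewrite Rintegral_waveM_same// mulr1 mulr0 add0r.
by rewrite mulKf// gt_eqF.
Qed.

(** Constants are orthogonal to the waves of positive frequency. *)
Lemma fourier_add_cst f (g : R -> R) (s : R) k : (0 < k)%N ->
  (forall x, I x -> g x = f x + s) ->
  fourier_cos l g k = fourier_cos l f k /\ fourier_sin l g k = fourier_sin l f k.
Proof.
move=> k0 gE.
suff H p q : p ^+ 2 + q ^+ 2 <= 1 ->
    \int[mu]_(x in I) (g x * wave p q (freq l k) x) =
    \int[mu]_(x in I) (f x * wave p q (freq l k) x).
  by rewrite !fourier_cosE !fourier_sinE !H// expr1n expr0n ?addr0 ?add0r.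
move=> pq; have [M fM] := bounded_BC f.
transitivity (\int[mu]_(x in I)
  (f x * wave p q (freq l k) x + wave (s * p) (s * q) (freq l k) x)).
  by apply: eq_Rintegral => x; rewrite inE => Ix; rewrite gE// /wave; ring.
rewrite RintegralD//.
- by rewrite Rintegral_wave// addr0.
- apply: (@bounded_integrable_itv _ _ l0 _ M).
    apply: measurable_funM; first exact: measurable_BC.
    apply: measurable_funTS.
    by apply: continuous_measurable_fun; exact: continuous_wave.
  move=> x Ix; rewrite normrM (le_trans _ (fM x Ix))// ler_piMr//.
  rewrite -(ler_pXn2r (n := 2))// ?nnegrE// expr1n real_normK ?num_real//.
  exact: le_trans (wave_sqr_le _ _ _ _) pq.
- exact/continuous_integrable_itv/continuous_wave.
Qed.

Lemma derive1_trig_term c d k x : (0 < k)%N ->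
  derive1 (trig_term l c d k) x =
  wave (freq l k * d k) (- (freq l k * c k)) (freq l k) x.
Proof.
move=> k0; rewrite (_ : trig_term l c d k = wave (c k) (d k) (freq l k)); last first.
  by apply/funext => y; rewrite trig_termE /half0 gtn_eqF.
rewrite derive1E; have [_ ->] := is_derive_wave (c k) (d k) (freq l k) x.
by rewrite /wave; ring.
Qed.

Lemma trig_term_cvg_bound c d (v : R -> R) :
  (forall x, I x -> series (fun k => trig_term l c d k x) @ \oo --> v x) ->
  \forall k \near \oo, c k ^+ 2 + d k ^+ 2 <= 1.
Proof.
move=> cv; have H : \forall k \near \oo, half0 c k ^+ 2 + d k ^+ 2 <= 1.
  apply: (@cantor_lebesgue R l l0 (half0 c) d) => x Ix.
  under eq_fun do rewrite -trig_termE.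
  by apply: cvg_series_cvg_0; apply/cvg_ex; exists (v x); exact: cv.
near=> k.
have k0 : (0 < k)%N by near: k; exists 1%N.
have : half0 c k ^+ 2 + d k ^+ 2 <= 1 by near: k.
by rewrite /half0 gtn_eqF.
Unshelve. all: by end_near. Qed.

Lemma derive1_series_bound c d (v : R -> R) :
  (forall x, I x -> series (fun k => derive1 (trig_term l c d k) x) @ \oo --> v x) ->
  \forall k \near \oo, freq l k ^+ 2 * (c k ^+ 2 + d k ^+ 2) <= 1.
Proof.
move=> cv.
have : \forall k \near \oo,
    (freq l k * d k) ^+ 2 + (- (freq l k * c k)) ^+ 2 <= 1.
  apply: (@cantor_lebesgue R l l0 (fun k => freq l k * d k)
    (fun k => - (freq l k * c k))) => x Ix.
  have c0 : derive1 (trig_term l c d k) x @[k --> \oo] --> 0.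
    by apply: cvg_series_cvg_0; apply/cvg_ex; exists (v x); exact: cv.
  apply: cvg_trans c0; apply: near_eq_cvg.
  by exists 1%N => // k /= k0; rewrite derive1_trig_term.
apply: filterS => k.
by rewrite sqrrN !exprMn -mulrDr addrC.
Qed.

End uniqueness.

(** * A summability criterion *)

Section summability.
Context {R : realType}.
Implicit Types (v f : nat -> R).

(** Comparison with a telescoping series. *)
Lemma telescope_bounded_sum v f (B : R) : (forall k, 0 <= v k) ->
  (forall k, 0 <= f k) -> 0 <= B ->
  (\forall k \near \oo, v k <= B * (f k - f k.+1)) ->
  exists C, forall n, \sum_(1 <= k < n) v k <= C.
Proof.
move=> v0 f0 B0 [N _ H]; pose M := maxn N 1.
exists (\sum_(1 <= k < M) v k + B * f M) => n.
have M1 : (1 <= M)%N by rewrite leq_max orbT.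
have nd n1 n2 : (1 <= n1 <= n2)%N ->
    \sum_(1 <= k < n1) v k <= \sum_(1 <= k < n2) v k.
  move=> /andP[n11 n12]; rewrite [leRHS](@big_cat_nat _ _ _ n1)//= lerDl.
  by apply: sumr_ge0.
have [nM|Mn] := leqP n M.
  apply: (@le_trans _ _ (\sum_(1 <= k < M) v k)); last by rewrite lerDl mulr_ge0.
  have [n0|n1] := posnP n; last by apply: nd; rewrite n1.
  by rewrite n0 big_geq// sumr_ge0.
rewrite (@big_cat_nat _ _ _ M)//=; last exact: ltnW.
rewrite lerD2l; apply: (@le_trans _ _ (\sum_(M <= k < n) (B * f k - B * f k.+1))).
  rewrite big_nat [leRHS]big_nat; apply: ler_sum => k /andP[Mk _].
  by rewrite -mulrBr; apply: H; rewrite /= (leq_trans _ Mk)// leq_max leqnn.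
have -> : \sum_(M <= k < n) (B * f k - B * f k.+1) = B * f M - B * f n.
  have := telescope_sumr (fun k => B * f k) (ltnW Mn).
  move=> E; rewrite -opprB -E -sumrN; apply: eq_bigr => k _.
  by rewrite opprB.
by rewrite gerBl mulr_ge0.
Qed.

Lemma sqrt_telescope k : (0 < k)%N ->
  (Num.sqrt k%:R ^+ 3)^-1 <=
  6 * ((Num.sqrt k%:R)^-1 - (Num.sqrt k.+1%:R)^-1) :> R.
Proof.
move=> k0; set q := Num.sqrt k%:R; set p := Num.sqrt _.
have q0 : 0 < q by rewrite sqrtr_gt0 ltr0n.
have q2 : q ^+ 2 = k%:R by rewrite sqr_sqrtr.
have p2 : p ^+ 2 = k%:R + 1 by rewrite sqr_sqrtr// -natr1.
have p0 : 0 < p by rewrite sqrtr_gt0 ltr0n.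
have k1 : 1 <= k%:R :> R by rewrite ler1n.
have pq : p <= 2 * q.
  rewrite -(ler_pXn2r (n := 2))// ?nnegrE ?mulr_ge0// ?ltW//.
  by rewrite p2 exprMn q2; lra.
have D : p ^+ 2 - q ^+ 2 = 1 by rewrite p2 q2; ring.
have -> : q^-1 - p^-1 = (q * p * (p + q))^-1.
  have -> : q^-1 - p^-1 = (p ^+ 2 - q ^+ 2) / (q * p * (p + q)).
    by field; rewrite !gt_eqF ?addr_gt0.
  by rewrite D mul1r.
rewrite -[6]invrK -invfM lef_pV2 ?posrE ?mulr_gt0 ?exprn_gt0 ?addr_gt0//.
rewrite mulrC -ler_pdivlMr ?invr_gt0// invrK.
rewrite (_ : q ^+ 3 * 6 = q * (2 * q) * (2 * q + q)); last by ring.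
apply: ler_pM.
- by rewrite mulr_ge0// ltW.
- by rewrite addr_ge0// ltW.
- by rewrite ler_pM2l.
- by rewrite lerD2r.
Qed.

(** The hypothesis says v_k = O(k^{-3/2}), and k^{-3/2} is dominated by the
    increments of k^{-1/2}. *)
Lemma bounded_sum_32 v (kappa : R) : 0 < kappa -> (forall k, 0 <= v k) ->
  (\forall k \near \oo, v k ^+ 4 * (k%:R * kappa) ^+ 6 <= 1) ->
  exists C, forall n, \sum_(1 <= k < n) v k <= C.
Proof.
move=> kp0 v0 H; pose x := kappa ^- 2; pose B := 1 + x.
have x0 : 0 < x by rewrite invr_gt0 exprn_gt0.
apply: (@telescope_bounded_sum v (fun k => (Num.sqrt k%:R)^-1) (6 * B)) => //.
  by rewrite mulr_ge0// addr_ge0// ltW.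
near=> k; have k0 : (0 < k)%N by near: k; exists 1%N.
rewrite mulrAC mulrC.
apply: (@le_trans _ _ (B * (Num.sqrt k%:R ^+ 3)^-1)); last first.
  by rewrite ler_pM2l ?addr_gt0//; exact: sqrt_telescope.
have q0 : 0 < Num.sqrt k%:R :> R by rewrite sqrtr_gt0 ltr0n.
have q2 : Num.sqrt k%:R ^+ 2 = k%:R :> R by rewrite sqr_sqrtr.
rewrite ler_pdivlMr ?exprn_gt0//.
rewrite -(ler_pXn2r (n := 4))// ?nnegrE; last 2 first.
- by rewrite mulr_ge0// exprn_ge0// ltW.
- by rewrite addr_ge0// ltW.
have Hk : v k ^+ 4 * (k%:R * kappa) ^+ 6 <= 1 by near: k.
(* B^4 >= x^3 = kappa^{-6} *)
rewrite exprMn -exprM (_ : (3 * 4)%N = (2 * 6)%N)// exprM q2.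
apply: (@le_trans _ _ (x ^+ 3)).
  rewrite /x -exprVn -exprM exprVn -[leRHS]mul1r ler_pdivlMr ?exprn_gt0//.
  by rewrite -mulrA -exprMn.
rewrite /B; move: (ltW x0); nra.
Unshelve. all: by end_near. Qed.

End summability.

(** * The action of the semigroup on Fourier coefficients *)

Section semigroup_coefficients.
Context {R : realType} (l : R) (m : nat) (A : nat -> R).
Hypothesis l0 : 0 < l.
Local Notation I := `[- l, l[%classic.
Local Notation sg := (sigma_ l m A).
Local Notation om := (omega_ l m A).

(** The coefficients of e^{sA}f when c and d are those of f. *)
Definition evolved_cos (s : R) (c d : nat -> R) (k : nat) : R :=
  expR (sg k * s) * (c k * cos (om k * s) + d k * sin (om k * s)).

Definition evolved_sin (s : R) (c d : nat -> R) (k : nat) : R :=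
  expR (sg k * s) * (d k * cos (om k * s) - c k * sin (om k * s)).

(** In each frequency the semigroup is a rotation followed by a dilation. *)
Lemma evolved_sqr s c d k :
  evolved_cos s c d k ^+ 2 + evolved_sin s c d k ^+ 2 =
  expR (sg k * s) ^+ 2 * (c k ^+ 2 + d k ^+ 2).
Proof.
rewrite /evolved_cos /evolved_sin !exprMn -mulrDr; congr (_ * _).
rewrite -[RHS]mulr1 -(cos2Dsin2 (om k * s)); ring.
Qed.

(** The inverse of a rotation and a dilation is obtained by reversing time; this
    holds frequency by frequency, whatever the growth of the coefficients. *)
Lemma evolved_inverse s c d k :
  evolved_cos (- s) (evolved_cos s c d) (evolved_sin s c d) k = c k /\
  evolved_sin (- s) (evolved_cos s c d) (evolved_sin s c d) k = d k.
Proof.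
have e1 : expR (sg k * - s) * expR (sg k * s) = 1.
  by rewrite -expRD mulrN addNr expR0.
have cs := cos2Dsin2 (om k * s).
rewrite /evolved_cos /evolved_sin !mulrN cosN sinN.
rewrite mulrN in e1.
split; rewrite -[RHS]mul1r -e1 -[RHS]mulr1 -cs; ring.
Qed.

Lemma sigma_0 : sg 0 = A 0%N.
Proof.
rewrite /sigma_ big_nat_recl//= expr0 mul1r expr0 mulr1.
rewrite big1 ?addr0// => i _.
by rewrite doubleS !mul0r expr0n mulr0.
Qed.

Lemma omega_0 : om 0 = 0.
Proof.
by rewrite /omega_ big1// => i _; rewrite !mul0r expr0n mulr0.
Qed.

Lemma series_add_head (u v : nat -> R) (a y : R) :
  (forall k, (0 < k)%N -> v k = u k) ->
  v 0%N = u 0%N + a -> series u @ \oo --> y -> series v @ \oo --> y + a.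
Proof.
move=> vu v0 uy; apply: (@cvg_trans _ ((fun n => series u n + a) @ \oo)); last first.
  by apply: cvgD => //; exact: cvg_cst.
apply: near_eq_cvg; exists 1%N => // n /= n0.
rewrite /series/= !(@big_ltn _ _ _ 0 n)// v0 addrAC; congr (_ + _ + _).
by rewrite big_nat [RHS]big_nat; apply: eq_bigr => k /andP[k0 _]; rewrite vu.
Qed.

Lemma BC_indicE x : I x -> BC_indic l x = 1.
Proof. by move=> Ix; rewrite /BC_indic/= indicE mem_set. Qed.

Lemma semigroup_unique (s : R) (f g : BC l) :
  is_semigroup m A s f g -> semigroup m A s f = g.
Proof.
move=> gP; rewrite /semigroup.
case: xgetP => [h _ [_ hP]|/(_ g)]; last by move=> /(_ gP).
apply/val_inj/funext => x /=.
have [Ix|nIx] := pselect (I x); last first.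
  by have [_ _ h0] := BCP h; have [_ _ g0] := BCP g; rewrite h0// g0.
exact: cvg_unique (hP x Ix) (gP.2 x Ix).
Qed.

Variables (s : R) (theta g : BC l) (C : R).
Local Notation c := (fourier_cos l theta).
Local Notation d := (fourier_sin l theta).
Hypothesis FD0theta : FD0 theta.
Hypothesis sumC : forall n, \sum_(1 <= k < n)
  (evolved_cos s c d k ^+ 2 + evolved_sin s c d k ^+ 2) <= C.
Hypothesis cvg_g : forall x, I x ->
  series (fun k => semigroup_term l m A s c d k x) @ \oo --> g x.

(** Adding the constant r to a function adds 2 r to its coefficient of index 0. *)
Definition raised_cos (r : R) (k : nat) : R :=
  evolved_cos s c d k + (if k == 0%N then 2 * r else 0).

(** The coefficients of g + r I come from the uniqueness of the expansion: adding
    r to the series of g affects neither its convergence nor the sums from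
    index 1 on. *)
Lemma raised_fourier (r : R) (f : BC l) : f = g + r *: BC_indic l ->
  [/\ forall k, fourier_cos l f k = raised_cos r k,
      forall k, (0 < k)%N -> fourier_sin l f k = evolved_sin s c d k & FD0 f].
Proof.
move=> fE.
have sC n : \sum_(1 <= k < n) (raised_cos r k ^+ 2 + evolved_sin s c d k ^+ 2) <= C.
  apply: le_trans (sumC n); rewrite le_eqVlt; apply/orP; left; apply/eqP.
  apply: eq_big_nat => k /andP[k0 _].
  by rewrite /raised_cos gtn_eqF// addr0.
have cf x : I x ->
    series (fun k => trig_term l (raised_cos r) (evolved_sin s c d) k x) @ \oo
      --> f x.
  move=> Ix; rewrite fE BC_addE BC_scaleE BC_indicE// mulr1.
  apply: series_add_head (cvg_g x Ix) => [k k0|].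
    by apply: eq_trig_term => //; rewrite /raised_cos gtn_eqF// addr0.
  rewrite /semigroup_term /trig_term/= /raised_cos/=.
  by rewrite mulrDl; congr (_ + _); field.
have [fc fs] := @fourier_of_trig_series R l l0 _ _ f C sC cf.
split=> // x Ix; have := cf x Ix.
rewrite (_ : (fun k => trig_term _ _ _ _ _) = fun k => fourier_term l f k x)//.
by apply/funext => k; apply: eq_trig_term => [|k0]; rewrite ?fc ?fs.
Qed.

(** Reversing time recovers the coefficients of theta from those of g, and the
    constant r I is an eigenvector, for the eigenvalue exp(- s A_0) at time - s. *)
Lemma semigroup_inverse (r : R) (f : BC l) : f = g + r *: BC_indic l ->
  is_semigroup m A (- s) f (theta + (expR (- s * A 0%N) * r) *: BC_indic l).
Proof.
move=> fE; have [fc fs FDf] := raised_fourier r f fE.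
split=> // x Ix; rewrite BC_addE BC_scaleE BC_indicE// mulr1.
apply: series_add_head (FD0theta x Ix) => [k k0|].
  rewrite /semigroup_term /fourier_term.
  have [ec es] := evolved_inverse s c d k.
  by apply: eq_trig_term => [|_]; rewrite fc fs// /raised_cos gtn_eqF// addr0;
    [exact: ec|exact: es].
rewrite /fourier_term /semigroup_term /trig_term/= fc sigma_0 omega_0 !mul0r.
rewrite cos0 sin0.
rewrite /raised_cos/= /evolved_cos sigma_0 omega_0 mul0r cos0 sin0.
rewrite !mulr0 !mulr1 !addr0.
rewrite (_ : - s * A 0%N = - (A 0%N * s)); last by ring.
rewrite mulrN expRN; field.
by rewrite gt_eqF// expR_gt0.
Qed.

End semigroup_coefficients.

(** * Regular signals *)

Section regular_signal.
Context {R : realType} {dO : measure_display} {Omega : measurableType dO}.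
Context {P : probability Omega R}.
Variables (l : R) (m : nat) (A : nat -> R) (sigma : R) (J : R -> {RV P >-> R}).
Hypothesis l0 : 0 < l.
Hypothesis m1 : (1 <= m)%N.
Local Notation I := `[- l, l[%classic.

(** With y_k = exp(2 sigma_k s) and rho_k = c_k^2 + d_k^2, regularity at time 0
    bounds k^2 rho_k and regularity at time 4 s bounds y_k^4 rho_k. Since
    (y_k rho_k)^4 k^6 = (y_k^4 rho_k) (k^2 rho_k)^3, the sequence y_k rho_k, which
    is the sum of the squares of the evolved coefficients, is O(k^{-3/2}). *)
Lemma regularity_summable (theta : BC l) (s : R) : FD0 theta ->
  regularity m A sigma J theta -> 0 < s ->
  exists (g : BC l) (C : R),
   (forall x, I x -> series (fun k => semigroup_term l m A s
       (fourier_cos l theta) (fourier_sin l theta) k x) @ \oo --> g x) /\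
   (forall n, \sum_(1 <= k < n)
     (evolved_cos l m A s (fourier_cos l theta) (fourier_sin l theta) k ^+ 2 +
      evolved_sin l m A s (fourier_cos l theta) (fourier_sin l theta) k ^+ 2) <= C).
Proof.
set c := fourier_cos l theta; set d := fourier_sin l theta.
move=> FDtheta [reg _] s0.
(* A probability space is not empty: any outcome w will do, since the noise
   only shifts the limit of the series by a constant. *)
have [w _] : exists w : Omega, True.
  apply: contrapT => now; have := probability_setT P.
  rewrite (_ : setT = set0) ?measure0; last first.
    by apply/seteqP; split => // w _; apply: now; exists w.
  by move/eqP; rewrite eqe eq_sym oner_eq0.
have limit (t : R) : 0 <= t -> exists2 F : BC l, FD m.*2 F &
    forall x, I x -> series (fun k => semigroup_term l m A t c d k x) @ \oo -->
      F x - sigma * J t w.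
  move=> t0; have [F FDF cF] := reg t w t0; exists F => // x Ix.
  have := cF x Ix; rewrite BC_indicE// mulr1 => cFx.
  rewrite (_ : series _ = (fun n =>
    series (fun k => semigroup_term l m A t c d k x) n +
      sigma * J t w - sigma * J t w)); last by apply/funext => n; rewrite addrK.
  by apply: cvgB; [exact: cFx|exact: cvg_cst].
pose rho k := c k ^+ 2 + d k ^+ 2.
have rho_ge0 k : 0 <= rho k by rewrite addr_ge0// sqr_ge0.
(* Regularity at time 0 concerns the Fourier coefficients of theta plus a
   constant, which are those of theta from index 1 on. *)
have bound0 : \forall k \near \oo, freq l k ^+ 2 * rho k <= 1.
  have [F [_ [g [g0 gP]]] cF] := limit 0 (lexx _).
  have FE x : I x -> g 0%N x = theta x + sigma * J 0 w.
    move=> Ix; rewrite g0//; apply/eqP; rewrite -subr_eq; apply/eqP.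
    suff E : (fun k => semigroup_term l m A 0 c d k x) =
        (fun k => fourier_term l theta k x).
      have := cF x Ix; rewrite E => cFx.
      exact: cvg_unique cFx (FDtheta x Ix).
    apply/funext => k; rewrite /semigroup_term; apply: eq_trig_term => [|_].
      by rewrite !mulr0 expR0 cos0 sin0 !mulr0 !mulr1 mul1r addr0.
    by rewrite !mulr0 expR0 cos0 sin0 !mulr0 !mulr1 mul1r subr0.
  have [|_ dg] := gP 0%N; first by rewrite double_gt0.
  have H := @derive1_series_bound R l l0 _ _ (g 1%N) (fun x Ix => (dg x Ix).2).
  near=> k; have k0 : (0 < k)%N by near: k; exists 1%N.
  rewrite /rho /c /d.
  have [<- <-] := @fourier_add_cst R l l0 theta (g 0%N) _ k k0 FE.
  by near: k.
have bound4 : \forall k \near \oo,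
    expR (sigma_ l m A k * (4 * s)) ^+ 2 * rho k <= 1.
  have s4 : 0 <= 4 * s by rewrite mulr_ge0// ltW.
  have [F _ cF] := limit _ s4.
  have := @trig_term_cvg_bound R l l0 _ _ _ cF.
  apply: filterS => k; rewrite -/(evolved_cos l m A (4 * s) c d k).
  by rewrite -/(evolved_sin l m A (4 * s) c d k) evolved_sqr.
have [F _ cF] := limit s (ltW s0).
exists (F - (sigma * J s w) *: BC_indic l).
have kp0 : 0 < pi / l by rewrite divr_gt0// pi_gt0.
have [||C HC] := @bounded_sum_32 R (fun k => evolved_cos l m A s c d k ^+ 2 +
    evolved_sin l m A s c d k ^+ 2) _ kp0.
- by move=> k; rewrite addr_ge0// sqr_ge0.
- near=> k; rewrite evolved_sqr -/(rho k).
  rewrite (_ : k%:R * (pi / l) = freq l k); last by rewrite /freq mulrA.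
  set y := expR _.
  have H0 : freq l k ^+ 2 * rho k <= 1 by near: k.
  have H4 : (y ^+ 4) ^+ 2 * rho k <= 1.
    rewrite /y -expRM_natl (_ : _ * (_ * s) = sigma_ l m A k * (4 * s)); last by ring.
    by near: k.
  rewrite (_ : _ * _ = (y ^+ 4) ^+ 2 * rho k * (freq l k ^+ 2 * rho k) ^+ 3);
    last by ring.
  rewrite mulr_ile1// ?exprn_ile1// ?exprn_ge0// mulr_ge0// sqr_ge0//.
exists C; split=> // x Ix.
rewrite BC_addE -scaleNr BC_scaleE BC_indicE// mulr1.
exact: cF.
Unshelve. all: by end_near. Qed.

Lemma sample_mean_shift (g : BC l) (Z : nat -> BC l) (a : nat -> R) n :
  (forall k, Z k = g + a k *: BC_indic l) ->
  sample_mean Z n = g + (n.+1%:R^-1 * \sum_(k < n.+1) a k) *: BC_indic l.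
Proof.
move=> ZE; rewrite /sample_mean; under eq_bigr do rewrite ZE.
rewrite big_split/= sumr_const card_ord -scaler_suml scalerDr scalerA; congr (_ + _).
by rewrite -[g *+ _]scaler_nat scalerA mulVf ?scale1r// pnatr_eq0.
Qed.

(** For samples on the line g + R I the estimator is theta plus a multiple of the
    mean of their coordinates along I. *)
Lemma estimate_consistent (theta theta_star g : BC l) (C t0 : R)
    (Z : nat -> BC l) (a : nat -> R) :
  FD0 theta ->
  (forall n, \sum_(1 <= k < n)
     (evolved_cos l m A t0 (fourier_cos l theta) (fourier_sin l theta) k ^+ 2 +
      evolved_sin l m A t0 (fourier_cos l theta) (fourier_sin l theta) k ^+ 2) <= C) ->
  (forall x, I x -> series (fun k => semigroup_term l m A t0
       (fourier_cos l theta) (fourier_sin l theta) k x) @ \oo --> g x) ->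
  (forall k, Z k = g + a k *: BC_indic l) ->
  n.+1%:R^-1 * \sum_(k < n.+1) a k @[n --> \oo] --> 0 ->
  estimate m A t0 theta_star Z = theta.
Proof.
move=> FDtheta sC cg ZE a0.
pose r n := n.+1%:R^-1 * \sum_(k < n.+1) a k.
have isg n := @semigroup_inverse R l m A l0 t0 theta g C FDtheta sC cg (r n)
  (sample_mean Z n) (sample_mean_shift g Z a n ZE).
have TE n : Tn m A t0 n Z = theta + (expR (- t0 * A 0%N) * r n) *: BC_indic l.
  exact: semigroup_unique.
have cT : (fun n => Tn m A t0 n Z) @ \oo --> theta.
  rewrite (funext TE) -[X in _ --> X]addr0; apply: cvgD; first exact: cvg_cst.
  rewrite -(scale0r (BC_indic l)); apply: cvgZr_tmp.
  by rewrite -(mulr0 (expR (- t0 * A 0%N))); apply: cvgM; [exact: cvg_cst|exact: a0].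
have lT : limn (fun n => Tn m A t0 n Z) = theta by exact: cvg_lim.
rewrite /estimate lT ifT//; apply/asboolP; split; last split=> //.
by move=> n; eexists; exact: isg.
Qed.

End regular_signal.

(** * A strong law of large numbers for orthogonal sequences *)

Section slln.
Context d (T : measurableType d) (R : realType) (P : probability T R).
Variables (X : nat -> T -> R) (v : R).
Hypothesis mX : forall i, measurable_fun setT (X i).
Hypothesis intX2 : forall i, (\int[P]_x (X i x ^+ 2)%:E <= v%:E)%E.
Hypothesis orthX : forall i j, i != j -> \int[P]_x (X i x * X j x) = 0.

Lemma second_moment_ge0 : 0 <= v.
Proof.
rewrite -lee_fin; apply: le_trans (intX2 0).
by apply: integral_ge0 => x _; rewrite lee_fin sqr_ge0.
Qed.

Lemma integrable_sqr i : P.-integrable setT (EFin \o (fun x => X i x ^+ 2)).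
Proof.
apply/integrableP; split.
  by apply/measurable_EFinP; exact: measurable_funX.
under eq_integral do rewrite /= ger0_norm ?sqr_ge0//.
exact: le_lt_trans (intX2 i) (ltry _).
Qed.

Lemma integrable_mul i j : P.-integrable setT (EFin \o (fun x => X i x * X j x)).
Proof.
apply: (@le_integrable _ _ _ P setT measurableT _
    (EFin \o (fun x => X i x ^+ 2 + X j x ^+ 2))).
- by apply/measurable_EFinP; exact: measurable_funM.
- move=> x _; rewrite /= lee_fin [leRHS]ger0_norm ?addr_ge0 ?sqr_ge0// normrM.
  rewrite -(@real_normK _ (X i x)) ?num_real// -(@real_normK _ (X j x)) ?num_real//.
  by move: `|X i x| `|X j x| (normr_ge0 (X i x)) (normr_ge0 (X j x)) => a b a0 b0; nra.
- by apply: integrableD_EFin => //; exact: integrable_sqr.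
Qed.

Lemma Rintegral_sqr_le i : \int[P]_x (X i x * X i x) <= v.
Proof.
rewrite -lee_fin /Rintegral fineK; last first.
  by apply: integrable_fin_num => //; exact: integrable_mul.
by apply: le_trans (intX2 i); under eq_integral do rewrite -expr2.
Qed.

Lemma integral_sum_sqr_le (r : seq nat) : uniq r ->
  (\int[P]_x ((\sum_(k <- r) X k x) ^+ 2)%:E <= ((size r)%:R * v)%:E)%E.
Proof.
move=> ur; rewrite -[leLHS]fineK; last first.
  apply: integrable_fin_num => //.
  by apply: (@integrable_sum_sqr _ _ _ P setT _ X) => //; exact: integrable_mul.
rewrite lee_fin -/(Rintegral _ _ _).
rewrite (@Rintegral_sum_sqr _ _ _ P setT _ X integrable_mul orthX)//.
apply: (@le_trans _ _ (\sum_(k <- r) v)).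
  by apply: ler_sum => k _; exact: Rintegral_sqr_le.
by rewrite big_const_seq count_predT iter_addr addr0 mulr_natl.
Qed.

(** Cauchy-Schwarz against the constant sequence 1. *)
Lemma sqr_sum_le (r : seq nat) (a : nat -> R) :
  (\sum_(k <- r) a k) ^+ 2 <= (size r)%:R * \sum_(k <- r) a k ^+ 2.
Proof.
rewrite expr2 big_distrlr/=.
apply: (@le_trans _ _ (\sum_(i <- r) \sum_(j <- r) (a i ^+ 2 / 2 + a j ^+ 2 / 2))).
  apply: ler_sum => i _; apply: ler_sum => j _.
  rewrite -subr_ge0 (_ : _ - _ = (a i - a j) ^+ 2 / 2); last by field.
  by rewrite divr_ge0// sqr_ge0.
have cst (z : R) : \sum_(j <- r) z = (size r)%:R * z.
  by rewrite big_const_seq count_predT iter_addr addr0 mulr_natl.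
rewrite (eq_bigr (fun i =>
  (size r)%:R * (a i ^+ 2 / 2) + \sum_(j <- r) a j ^+ 2 / 2)).
  rewrite big_split/= cst -mulr_sumr.
  by rewrite -!mulr_suml; lra.
by move=> i _; rewrite big_split/= cst.
Qed.

Lemma integral_sum_abs_sqr_le (r : seq nat) :
  (\int[P]_x ((\sum_(k <- r) `|X k x|) ^+ 2)%:E <= ((size r)%:R ^+ 2 * v)%:E)%E.
Proof.
have mabs k : measurable_fun setT (fun x => `|X k x|) by exact: measurableT_comp.
have ms : P.-integrable setT (EFin \o (fun x =>
  (size r)%:R * \sum_(k <- r) X k x ^+ 2)).
  apply: integrableZ_EFin => //;
    apply: (@integrable_fsum _ _ _ P setT _ _ (fun k x => X k x ^+ 2)) => //.
  exact: integrable_sqr.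
apply: (@le_trans _ _ (\int[P]_x ((size r)%:R * \sum_(k <- r) X k x ^+ 2)%:E)%E).
  apply: ge0_le_integral => //.
  - by move=> x _; rewrite lee_fin sqr_ge0.
  - by apply/measurable_EFinP; apply: measurable_funX; apply: measurable_sum.
  - exact: measurable_int ms.
  - move=> x _; rewrite lee_fin (le_trans (sqr_sum_le _ _))//.
    by under eq_bigr do rewrite real_normK ?num_real//.
rewrite -[leLHS]fineK; last exact: integrable_fin_num.
rewrite lee_fin -/(Rintegral _ _ _) RintegralZl//; last first.
  apply: (@integrable_fsum _ _ _ P setT _ _ (fun k x => X k x ^+ 2)) => //.
  exact: integrable_sqr.
rewrite (@Rintegral_fsum _ _ _ P setT _ r (fun k x => X k x ^+ 2))//;
  last exact: integrable_sqr.
rewrite [_ ^+ 2]expr2 -mulrA ler_wpM2l//.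
apply: (@le_trans _ _ (\sum_(k <- r) v)).
  apply: ler_sum => k _; apply: le_trans (Rintegral_sqr_le k).
  by under eq_Rintegral do rewrite expr2.
by rewrite big_const_seq count_predT iter_addr addr0 mulr_natl.
Qed.

End slln.

Section subsequence.
Context {R : realType}.

Lemma nat_sqrt N : exists r, (r ^ 2 <= N < r.+1 ^ 2)%N.
Proof.
elim: N => [|N [r /andP[rN Nr]]]; first by exists 0%N.
have [lt|ge] := ltnP N.+1 (r.+1 ^ 2).
  by exists r; rewrite lt (leq_trans rN).
exists r.+1; rewrite ge (leq_trans (_ : (N.+1 < (r.+1 ^ 2).+1)%N))//.
by rewrite ltn_exp2r.
Qed.

(** Between two consecutive squares the sum of the a_k moves by at most the sum
    of the |a_k|, so the means are controlled by their values along the squares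
    and by these oscillations, both collected in Y. *)
Lemma mean_cvg0 (a : nat -> R) (Y : nat -> R) :
  (forall n, Y n = (\sum_(0 <= k < n.+1 ^ 2) a k) ^+ 2 / n.+1%:R ^+ 4 +
    (\sum_(n.+1 ^ 2 <= k < n.+2 ^ 2) `|a k|) ^+ 2 / n.+1%:R ^+ 4) ->
  Y @ \oo --> 0 ->
  N.+1%:R^-1 * \sum_(k < N.+1) a k @[N --> \oo] --> 0.
Proof.
move=> YE /cvgrPdist_le Y0; apply/cvgrPdist_le => e e0.
have e2 : 0 < e ^+ 2 / 2 by rewrite divr_gt0// exprn_gt0.
have [n0 _ H] := Y0 _ e2.
exists (n0.+1 ^ 2)%N => // N /= nN.
have [r /andP[rN Nr]] := nat_sqrt N.+1.
have n0r : (n0 < r)%N.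
  rewrite -ltnS -(ltn_exp2r _ _ (e := 2))//.
  exact: leq_ltn_trans (leq_trans nN (leqnSn N)) Nr.
case: r => // n in rN Nr n0r *.
have := H n n0r; rewrite sub0r normrN YE.
set S := \sum_(0 <= k < n.+1 ^ 2) a k; set D := \sum_(_ <= _ < _) _.
set q : R := n.+1%:R ^+ 4.
have q0 : 0 < n.+1%:R :> R by rewrite ltr0n.
rewrite ger0_norm ?addr_ge0 ?divr_ge0 ?sqr_ge0 ?exprn_ge0// => SD.
have SN : `|\sum_(k < N.+1) a k| <= `|S| + D.
  rewrite -(big_mkord xpredT) (@big_cat_nat _ _ _ (n.+1 ^ 2)%N)//=.
  rewrite (le_trans (ler_normD _ _))// lerD2l (le_trans (ler_norm_sum _ _ _))//.
  rewrite /D [leRHS](@big_cat_nat _ _ _ N.+1)//=; last exact: ltnW.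
  by rewrite lerDl sumr_ge0.
rewrite sub0r normrN normrM ger0_norm ?invr_ge0// ler_pdivrMl ?ltr0n//.
apply: (le_trans SN).
have D0 : 0 <= D by rewrite sumr_ge0.
have SD2 : (`|S| + D) ^+ 2 <= (n.+1%:R ^+ 2 * e) ^+ 2.
  apply: (@le_trans _ _ (2 * (`|S| ^+ 2 + D ^+ 2))).
    by rewrite -subr_ge0 (_ : _ - _ = (`|S| - D) ^+ 2) ?sqr_ge0//; ring.
  rewrite real_normK ?num_real// mulrC -ler_pdivlMr//.
  move: SD; rewrite -mulrDl ler_pdivrMr ?exprn_gt0// => SD.
  by apply: (le_trans SD); rewrite /q le_eqVlt; apply/orP; left; apply/eqP; field.
apply: (@le_trans _ _ (n.+1%:R ^+ 2 * e)).
  rewrite -(ler_pXn2r (n := 2))// ?nnegrE ?addr_ge0//.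
  by rewrite mulr_ge0 ?sqr_ge0// ltW.
by rewrite ler_pM2r// -natrX ler_nat.
Qed.

End subsequence.

(** The second moments of the mean at n^2 and of the oscillation up to (n+1)^2 are
    O(n^{-2}), so the series of the squares has a finite expectation; it converges
    almost everywhere, and its terms tend to 0. *)
Lemma slln_orthogonal d (T : measurableType d) (R : realType) (P : probability T R)
  (X : nat -> T -> R) (v : R) :
  (forall i, measurable_fun setT (X i)) ->
  (forall i, (\int[P]_x (X i x ^+ 2)%:E <= v%:E)%E) ->
  (forall i j, i != j -> \int[P]_x (X i x * X j x) = 0) ->
  {ae P, forall x, N.+1%:R^-1 * \sum_(k < N.+1) X k x @[N --> \oo] --> 0}.
Proof.
move=> mX intX2 orthX.
have v0 : 0 <= v by exact: second_moment_ge0 intX2.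
pose S n x := \sum_(0 <= k < n.+1 ^ 2) X k x.
pose D n x := \sum_(n.+1 ^ 2 <= k < n.+2 ^ 2) `|X k x|.
pose Y n x := S n x ^+ 2 / n.+1%:R ^+ 4 + D n x ^+ 2 / n.+1%:R ^+ 4.
have q0 n : 0 <= (n.+1%:R ^+ 4)^-1 :> R by rewrite invr_ge0 exprn_ge0.
have Y0 n x : 0 <= Y n x by rewrite addr_ge0// mulr_ge0// sqr_ge0.
have mS n : measurable_fun setT (fun x => S n x ^+ 2).
  by apply: measurable_funX; apply: measurable_sum.
have mD n : measurable_fun setT (fun x => D n x ^+ 2).
  by apply: measurable_funX; apply: measurable_sum => k; exact: measurableT_comp.
have mY n : measurable_fun setT (fun x => (Y n x)%:E).
  by apply/measurable_EFinP; apply: measurable_funD; apply: measurable_funM.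
(* The integral of Y n is at most (v + 9 v) / (n+1)^2. *)
pose b n : R := 20 * v * (n.+1%:R^-1 - n.+2%:R^-1).
have intY n : (\int[P]_x (Y n x)%:E <= (b n)%:E)%E.
  have -> : (\int[P]_x (Y n x)%:E = \int[P]_x
    ((S n x ^+ 2)%:E * (n.+1%:R ^- 4)%:E + (D n x ^+ 2)%:E * (n.+1%:R ^- 4)%:E))%E by [].
  rewrite ge0_integralD//; last 4 first.
  - by move=> x _; rewrite -EFinM lee_fin mulr_ge0// sqr_ge0.
  - by apply/measurable_EFinP; apply: measurable_funM.
  - by move=> x _; rewrite -EFinM lee_fin mulr_ge0// sqr_ge0.
  - by apply/measurable_EFinP; apply: measurable_funM.
  rewrite !ge0_integralZr//; last 4 first.
  - exact/measurable_EFinP.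
  - by move=> x _; rewrite lee_fin sqr_ge0.
  - exact/measurable_EFinP.
  - by move=> x _; rewrite lee_fin sqr_ge0.
  have I1 := integral_sum_sqr_le d T R P X v mX intX2 orthX
    (index_iota 0 (n.+1 ^ 2)) (iota_uniq _ _).
  have I2 := integral_sum_abs_sqr_le d T R P X v mX intX2
    (index_iota (n.+1 ^ 2) (n.+2 ^ 2)).
  apply: (le_trans (leeD (lee_wpmul2r _ I1) (lee_wpmul2r _ I2))); rewrite ?lee_fin//.
  rewrite !size_iota subn0.
  have -> : (n.+2 ^ 2 - n.+1 ^ 2 = 2 * n.+1 + 1)%N.
    by rewrite -[n.+2]addn1 sqrnD; lia.
  rewrite /b natrX natrD natrM -[n.+2]addn1 [(n.+1 + 1)%:R]natrD.
  have : 1 <= n.+1%:R :> R by rewrite ler1n.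
  move: (n.+1%:R : R) => z z1.
  have z0 : 0 < z by rewrite (lt_le_trans _ z1).
  rewrite (_ : _ + _ = v * ((z ^+ 2 + (2 * z + 1) ^+ 2) / z ^+ 4)); last by ring.
  rewrite (_ : 20 * v * _ = v * (20 / (z * (z + 1)))); last first.
    by field; rewrite !gt_eqF// addr_gt0.
  rewrite ler_wpM2l// ler_pdivrMr ?exprn_gt0// mulrAC.
  rewrite ler_pdivlMr ?mulr_gt0 ?addr_gt0//.
  rewrite [leLHS](_ : _ = z * ((5 * z ^+ 2 + 4 * z + 1) * (z + 1))); last by ring.
  rewrite [leRHS](_ : _ = z * (20 * z ^+ 3)); last by ring.
  by rewrite ler_pM2l//; nra.
have sumY : (\int[P]_x (\sum_(0 <= n <oo) (Y n x)%:E) <= (20 * v)%:E)%E.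
  rewrite integral_nneseries//; last by move=> n x _; rewrite lee_fin.
  apply: lime_le.
    apply: is_cvg_nneseries => n _ _.
    by apply: integral_ge0 => x _; rewrite lee_fin.
  apply: nearW => N; apply: (@le_trans _ _ (\sum_(0 <= n < N) (b n)%:E)%E).
    by apply: lee_sum => n _; exact: intY.
  rewrite sumEFin lee_fin /b -mulr_sumr ler_piMr ?mulr_ge0//.
  have := telescope_sumr (fun n => n.+1%:R^-1 : R) (leq0n N).
  under eq_bigr do rewrite -opprB.
  rewrite sumrN => /(congr1 -%R); rewrite opprK => ->.
  by rewrite opprB invr1 gerBl invr_ge0.
have ae : {ae P, forall x, setT x -> (\sum_(0 <= n <oo) (Y n x)%:E)%E \is a fin_num}.
  apply: integrable_ae => //; apply/integrableP; split.
    by apply: ge0_emeasurable_sum => // n x _ _; rewrite lee_fin.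
  under eq_integral.
    move=> x _; rewrite gee0_abs; last first.
      by apply: nneseries_ge0 => n _ _; rewrite lee_fin.
    over.
  exact: le_lt_trans sumY (ltry _).
apply: filterS ae => x /(_ Logic.I) Yfin.
apply: (@mean_cvg0 _ (X^~ x) (Y^~ x)) => //.
apply: cvg_series_cvg_0; apply: nondecreasing_is_cvgn.
  apply/nondecreasing_seqP => n; rewrite /series/= [leRHS]big_nat_recr//= lerDl.
  exact: Y0.
exists (fine (\sum_(0 <= n <oo) (Y n x)%:E)%E) => _ [n _ <-].
rewrite -lee_fin fineK// /series/= -sumEFin.
by apply: nneseries_lim_ge => k _ _; rewrite lee_fin.
Qed.

(** * Moments of the Wiener integral *)

Section normal_moments.
Context {R : realType}.
Local Notation mu := (@lebesgue_measure R).
Variable s : R.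
Hypothesis s0 : s != 0.
Local Notation nu := (normal_prob 0 s).

Lemma normal_pdf_opp x : normal_pdf 0 s (- x) = normal_pdf 0 s x.
Proof. by rewrite normal_pdfE// /normal_fun !subr0 sqrrN. Qed.

Lemma normal_prob_opp (B : set R) : measurable B -> nu (-%R @^-1` B) = nu B.
Proof.
move=> mB; rewrite /normal_prob.
transitivity (\int[pushforward mu (-%R : _ -> measurableTypeR R)]_(x in B)
  (normal_pdf 0 s x)%:E)%E.
  rewrite (@ge0_integral_pushforward _ _ _ _ _
    (-%R : measurableTypeR R -> measurableTypeR R) _ mu B).
  - by apply: eq_integral => x _; rewrite /= normal_pdf_opp.
  - exact: oppr_measurable.
  - exact: mB.
  - by apply/measurable_EFinP; apply: measurable_funTS; exact: measurable_normal_pdf.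
  - by move=> y _; rewrite lee_fin normal_pdf_ge0.
by apply: eq_measure_integral => //= D mD _; exact: lebesgue_measureN.
Qed.

(** Integration against the density, by the uniqueness of the Radon-Nikodym
    derivative. *)
Lemma ge0_integral_normal_prob (f : R -> \bar R) : measurable_fun setT f ->
  (forall x, 0 <= f x)%E ->
  (\int[nu]_x f x = \int[mu]_x (f x * (normal_pdf 0 s x)%:E))%E.
Proof.
move=> mf f0; have dom := normal_prob_dominates 0 s.
rewrite -(Radon_Nikodym_SigmaFinite.change_of_variables dom)//.
have ig := Radon_Nikodym_SigmaFinite.f_integrable dom.
apply: ae_eq_integral => //.
- by apply: emeasurable_funM => //; exact: measurable_int ig.
- by apply: emeasurable_funM => //; apply/measurable_EFinP;
    exact: measurable_normal_pdf.
apply: ae_eqe_mul2l.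
apply: integral_ae_eq => //.
- by apply/measurable_EFinP; exact: measurable_normal_pdf.
- by move=> E _ mE; rewrite -Radon_Nikodym_SigmaFinite.f_integral.
Qed.

(** The factor x^2 is absorbed by widening the Gaussian: x^2 times the density of
    deviation s is at most a multiple of the density of deviation 2 s. *)
Lemma normal_second_moment : (\int[nu]_x (x ^+ 2)%:E < +oo)%E.
Proof.
rewrite ge0_integral_normal_prob//; last 2 first.
- by apply/measurable_EFinP; exact: measurable_funX.
- by move=> x; rewrite lee_fin sqr_ge0.
pose r := s * 2.
have r0 : r != 0 by rewrite mulf_neq0.
have pr : 0 < normal_peak r by exact: normal_peak_gt0.
have ps : 0 < normal_peak s by exact: normal_peak_gt0.
have s2 : 0 < s ^+ 2 by rewrite exprn_even_gt0.
(* With u = 3 x^2 / (8 s^2), the exponential of - x^2 / (2 s^2) is the product of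
   those of - u and of - x^2 / (2 r^2), and u <= exp u. *)
pose K := normal_peak s * (8 * s ^+ 2 / 3) / normal_peak r.
apply: (@le_lt_trans _ _ (\int[mu]_x (K * normal_pdf 0 r x)%:E)%E).
  apply: ge0_le_integral => //.
  - by move=> x _; rewrite -EFinM lee_fin mulr_ge0 ?sqr_ge0// normal_pdf_ge0.
  - under eq_fun do rewrite -EFinM.
    apply/measurable_EFinP; apply: measurable_funM; last exact: measurable_normal_pdf.
    exact: measurable_funX.
  - apply/measurable_EFinP; apply: measurable_funM => //; exact: measurable_normal_pdf.
  - move=> x _; rewrite -EFinM lee_fin !normal_pdfE//.
    rewrite /K mulrA divfK ?gt_eqF// mulrCA -mulrA ler_pM2l//.
    rewrite /normal_fun !subr0.
    pose u := 3 * x ^+ 2 / (8 * s ^+ 2).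
    rewrite (_ : - x ^+ 2 / (s ^+ 2 *+ 2) = - u + - x ^+ 2 / (r ^+ 2 *+ 2)); last first.
      by rewrite /u /r; field; rewrite ?s0.
    rewrite expRD mulrA ler_pM2r ?expR_gt0// expRN ler_pdivrMr ?expR_gt0//.
    rewrite (_ : x ^+ 2 = 8 * s ^+ 2 / 3 * u); last by rewrite /u; field.
    have k0 : 0 < 8 * s ^+ 2 / 3 by apply: divr_gt0 => //; exact: mulr_gt0.
    rewrite ler_pM2l//.
    by rewrite (le_trans _ (expR_ge1Dx u))// lerDr.
have : mu.-integrable setT (EFin \o (fun x => K * normal_pdf 0 r x)).
  by apply: integrableZ_EFin => //; exact: integrable_normal_pdf.
by move/(integrable_lty measurableT).
Qed.

Lemma integrable_id_normal : nu.-integrable setT (EFin \o (fun x : R => x)).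
Proof.
apply: (@le_integrable _ _ _ nu setT measurableT _ (EFin \o (fun x => 1 + x ^+ 2))).
- exact/measurable_EFinP.
- move=> x _; rewrite /= lee_fin [leRHS]ger0_norm ?addr_ge0 ?sqr_ge0//.
  by rewrite -[x ^+ 2]real_normK ?num_real//; move: `|x| => y; nra.
apply: integrableD_EFin => //.
  exact: (@finite_measure_integrable_cst _ _ _ nu setT 1).
apply/integrableP; split; first by apply/measurable_EFinP; exact: measurable_funX.
under eq_integral do rewrite /= ger0_norm ?sqr_ge0//.
exact: normal_second_moment.
Qed.

(** By symmetry the mean is its own opposite. *)
Lemma normal_mean : \int[nu]_x x = 0.
Proof.
have H : \int[nu]_x (- x) = \int[nu]_x x.
  congr fine.
  transitivity (\int[pushforward nu
    (-%R : measurableTypeR R -> measurableTypeR R)]_x (x : R)%:E)%E.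
    rewrite integral_pushforward.
    - by rewrite preimage_setT.
    - exact: oppr_measurable.
    - by apply/measurable_EFinP; exact: measurable_id.
    - rewrite preimage_setT.
      rewrite (_ : _ \o _ = EFin \o (fun x : R => -1 * x)); last first.
        by apply/funext => x; rewrite /= mulN1r.
      by apply: integrableZ_EFin => //; exact: integrable_id_normal.
    - exact: measurableT.
  by apply: eq_measure_integral => B mB _; exact: normal_prob_opp.
have : \int[nu]_x (- x) = - \int[nu]_x x.
  under eq_Rintegral do rewrite -mulN1r.
  by rewrite RintegralZl ?mulN1r//; exact: integrable_id_normal.
by rewrite H => /eqP; rewrite -addr_eq0 -mulr2n mulrn_eq0/= => /eqP.
Qed.

End normal_moments.

Section wiener_moments.
Context {R : realType} {d : measure_display} {Omega : measurableType d}.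
Variable P : probability Omega R.

Definition centered_L2 (X : Omega -> R) : Prop :=
  [/\ measurable_fun setT X,
      P.-integrable setT (EFin \o (fun w => X w ^+ 2)) &
      \int[P]_w X w = 0].

Lemma integrable_of_sqr (X : Omega -> R) : measurable_fun setT X ->
  P.-integrable setT (EFin \o (fun w => X w ^+ 2)) ->
  P.-integrable setT (EFin \o X).
Proof.
move=> mX X2; apply: (@le_integrable _ _ _ P setT measurableT _
    (EFin \o (fun w => 1 + X w ^+ 2))).
- exact/measurable_EFinP.
- move=> x _; rewrite /= lee_fin [leRHS]ger0_norm ?addr_ge0 ?sqr_ge0//.
  by rewrite -[X x ^+ 2]real_normK ?num_real//; move: `|X x| => y; nra.
apply: integrableD_EFin => //.
exact: (@finite_measure_integrable_cst _ _ _ P setT 1).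
Qed.

Lemma integrable_sqr_le (X : Omega -> R) (g : Omega -> R) : measurable_fun setT X ->
  P.-integrable setT (EFin \o g) -> (forall w, X w ^+ 2 <= g w) ->
  P.-integrable setT (EFin \o (fun w => X w ^+ 2)).
Proof.
move=> mX ig Xg.
apply: (@le_integrable _ _ _ P setT measurableT _ (EFin \o g)) => //.
  by apply/measurable_EFinP; exact: measurable_funX.
move=> w _; rewrite /= lee_fin ger0_norm ?sqr_ge0//.
by rewrite (le_trans (Xg w))// ler_norm.
Qed.

Lemma centered_L2_normal (X : Omega -> R) (s : R) : s != 0 ->
  measurable_fun setT X ->
  (forall B, measurable B -> P (X @^-1` B) = normal_prob 0 s B) -> centered_L2 X.
Proof.
move=> s0 mX XN.
have mX' : measurable_fun setT (X : Omega -> measurableTypeR R) by exact: mX.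
pose X' : {mfun Omega >-> measurableTypeR R} :=
  @mfun_Sub _ _ Omega (measurableTypeR R) X (mem_set mX').
have EN (f : measurableTypeR R -> \bar R) :
    (\int[distribution P X']_x f x = \int[normal_prob 0 s]_x f x)%E.
  by apply: eq_measure_integral => B mB _; exact: XN.
have X2 : P.-integrable setT (EFin \o (fun w => X w ^+ 2)).
  apply/integrableP; split; first by apply/measurable_EFinP; exact: measurable_funX.
  under eq_integral do rewrite /= ger0_norm ?sqr_ge0//.
  have := @ge0_integral_distribution _ _ _ _ _ P X' (fun x => (x ^+ 2)%:E).
  rewrite EN /comp/= => <-.
  - exact: normal_second_moment.
  - by apply/measurable_EFinP; exact: measurable_funX.
  - by move=> y; rewrite lee_fin sqr_ge0.
split=> //.
have := @integral_distribution _ _ _ _ _ P X' (EFin \o id).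
rewrite EN /comp/= => E.
rewrite /Rintegral -E//.
- exact: normal_mean.
- by apply/measurable_EFinP; exact: measurable_id.
- exact: integrable_of_sqr.
Qed.

Lemma centered_L2_0 (X : Omega -> R) : (forall w, X w = 0) -> centered_L2 X.
Proof.
move=> X0; rewrite (_ : X = cst 0); last by apply/funext.
split=> //; last by rewrite Rintegral_cst// mul0r.
rewrite (_ : _ \o _ = EFin \o cst 0); last by apply/funext => w /=; rewrite expr0n.
exact: (@finite_measure_integrable_cst _ _ _ P setT 0).
Qed.

Lemma centered_L2_sum (N : nat) (a : nat -> R) (X : nat -> Omega -> R) :
  (forall i, (i < N)%N -> centered_L2 (X i)) ->
  centered_L2 (fun w => \sum_(i < N) a i * X i w).
Proof.
elim: N => [|N IH] cX.
  by apply: centered_L2_0 => w; rewrite big_ord0.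
have [mS S2 S0] := IH (fun i iN => cX i (ltnW iN)).
have [mX X2 X0] := cX N (ltnSn N).
rewrite (_ : (fun w => _) =
  (fun w => \sum_(i < N) a i * X i w + a N * X N w)); last first.
  by apply/funext => w; rewrite big_ord_recr.
have iX := integrable_of_sqr _ mX X2; have iS := integrable_of_sqr _ mS S2.
have iaX : P.-integrable setT (EFin \o (fun w => a N * X N w)).
  exact: integrableZ_EFin.
have mD : measurable_fun setT (fun w => \sum_(i < N) a i * X i w + a N * X N w).
  by apply: measurable_funD => //; apply: measurable_funM.
split=> //.
  apply: (integrable_sqr_le _ (fun w =>
    2 * (\sum_(i < N) a i * X i w) ^+ 2 + (2 * a N ^+ 2) * X N w ^+ 2)) => //.
    by apply: integrableD_EFin => //; exact: integrableZ_EFin.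
  move=> w; rewrite -subr_ge0.
  rewrite (_ : _ - _ = (\sum_(i < N) a i * X i w - a N * X N w) ^+ 2) ?sqr_ge0//; ring.
by rewrite RintegralD// RintegralZl// S0 X0 mulr0 addr0.
Qed.

(** Square integrability and mean 0 are stable under limits in L^2: the limit X is
  within finite
    L^2 distance of some Y n, and its mean is the limit of the means. *)
Lemma centered_L2_limit (Y : nat -> Omega -> R) (X : Omega -> R) :
  measurable_fun setT X -> (forall n, centered_L2 (Y n)) ->
  (\int[P]_w ((Y n w - X w) ^+ 2)%:E)%E @[n --> \oo] --> 0%E -> centered_L2 X.
Proof.
move=> mX cY YX.
have mYX n : measurable_fun setT (fun w => Y n w - X w).
  by have [mY _ _] := cY n; exact: measurable_funB.
have close (e : R) : 0 < e ->
    exists2 n, P.-integrable setT (EFin \o (fun w => (Y n w - X w) ^+ 2)) &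
    \int[P]_w ((Y n w - X w) ^+ 2) <= e.
  move=> e0; move/fine_cvgP : YX => [YXf /cvgrPdist_le/(_ e e0)].
  case: YXf => n1 _ H1 [n2 _ H2].
  have := H2 (maxn n1 n2) (leq_maxr _ _); rewrite sub0r normrN /= => H.
  exists (maxn n1 n2); last exact: le_trans (ler_norm _) H.
  apply/integrableP; split; first by apply/measurable_EFinP; exact: measurable_funX.
  under eq_integral do rewrite /= ger0_norm ?sqr_ge0//.
  rewrite -ge0_fin_numE; last by apply: integral_ge0 => w _; rewrite lee_fin sqr_ge0.
  by apply: H1; rewrite /= leq_maxl.
have [n i2 _] := close 1 ltr01.
have X2 : P.-integrable setT (EFin \o (fun w => X w ^+ 2)).
  have [_ Y2 _] := cY n.
  apply: (integrable_sqr_le _ (fun w => 2 * Y n w ^+ 2 + 2 * (Y n w - X w) ^+ 2)) => //.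
    by apply: integrableD_EFin => //; exact: integrableZ_EFin.
  move=> w; rewrite -subr_ge0.
  by rewrite (_ : _ - _ = (2 * Y n w - X w) ^+ 2) ?sqr_ge0//; ring.
split=> //; apply/eqP; rewrite -normr_eq0 eq_le normr_ge0 andbT.
apply/ler_addgt0Pl => e e0; rewrite addr0.
have e2 : 0 < e / 2 by rewrite divr_gt0.
have [k ik ke] := close ((e / 2) ^+ 2) (exprn_gt0 _ e2).
have [mY Y2 Y0] := cY k.
have iX := integrable_of_sqr _ mX X2; have iY := integrable_of_sqr _ mY Y2.
have iYX : P.-integrable setT (EFin \o (fun w => Y k w - X w)).
  exact: integrableB_EFin.
have -> : `|\int[P]_w X w| = `|\int[P]_w (Y k w - X w)|.
  by rewrite RintegralB// Y0 sub0r normrN.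
apply: (@le_trans _ _ (\int[P]_w `|Y k w - X w|)); first exact: le_normr_Rintegral.
have ic : P.-integrable setT (EFin \o cst (e / 2)).
  exact: finite_measure_integrable_cst.
have iZ : P.-integrable setT
    (EFin \o (fun w => (e / 2)^-1 * (Y k w - X w) ^+ 2)).
  exact: integrableZ_EFin.
apply: (@le_trans _ _ (\int[P]_w (e / 2 + (e / 2)^-1 * (Y k w - X w) ^+ 2))).
  apply: le_Rintegral => //.
  - exact: integrable_norm.
  - exact: integrableD_EFin.
  move=> w _; rewrite -[(_ - _) ^+ 2]real_normK ?num_real//.
  move: `|_| (normr_ge0 (Y k w - X w)) (e / 2) e2 => r r0 f f0.
  rewrite -subr_ge0 (_ : _ - _ = f^-1 * ((f - r) ^+ 2 + f * r)); last by field;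
    rewrite gt_eqF.
  by rewrite mulr_ge0 ?invr_ge0 ?addr_ge0 ?sqr_ge0 ?mulr_ge0// ltW.
have -> : \int[P]_w (e / 2 + (e / 2)^-1 * (Y k w - X w) ^+ 2) =
    e / 2 + (e / 2)^-1 * \int[P]_w ((Y k w - X w) ^+ 2).
  rewrite RintegralD// Rintegral_cst// RintegralZl//; congr (_ + _).
  by rewrite -[RHS]mulr1; congr (_ * _);
    rewrite -[RHS]/(fine 1%E) -(probability_setT P).
rewrite [leRHS](_ : e = e / 2 + (e / 2)^-1 * (e / 2) ^+ 2); last by field;
  rewrite gt_eqF.
by rewrite lerD2l ler_pM2l// invr_gt0.
Qed.

(** Step integrals are combinations of Gaussian increments. *)
Lemma wiener_integral_centered_L2 (W : R -> {RV P >-> R}) (f : R -> R) (t : R)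
    (X : {RV P >-> R}) :
  wiener_process W -> is_wiener_integral W f t X -> centered_L2 X.
Proof.
move=> [_ _ WN _] [N [s [a [sP _ cX]]]].
apply: centered_L2_limit cX => // n.
have [s0 _ sS] := sP n.
have s_ge0 i : 0 <= s n i by elim: i => [|i IH]; rewrite ?s0// (le_trans IH).
apply: (@centered_L2_sum (N n) (a n) (fun i w => W (s n i.+1) w - W (s n i) w)) => i _.
have [E|ne] := eqVneq (s n i) (s n i.+1).
  by apply: centered_L2_0 => w; rewrite E subrr.
have lt : s n i < s n i.+1 by rewrite lt_neqAle ne sS.
apply: (@centered_L2_normal _ (Num.sqrt (s n i.+1 - s n i))).
- by rewrite gt_eqF// sqrtr_gt0 subr_gt0.
- exact: measurable_funB.
- by move=> B mB; exact: WN.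
Qed.

End wiener_moments.

(** * Countable products and completed measures *)

(** The hypothesis on rectangles says that the pair (X, Y) has law mu x mu;
    Fubini then factors the expectation of the product. *)
Lemma Rintegral_mul_independent {d d'} {T : measurableType d} {S : measurableType d'}
    {R : realType} (M : probability T R) (mu : probability S R)
    (X Y : T -> S) (h : S -> R) :
  measurable_fun setT X -> measurable_fun setT Y -> measurable_fun setT h ->
  (forall A B, measurable A -> measurable B ->
     M (X @^-1` A `&` Y @^-1` B) = mu A * mu B)%E ->
  M.-integrable setT (EFin \o (fun z => h (X z) * h (Y z))) ->
  mu.-integrable setT (EFin \o h) -> \int[mu]_x h x = 0 ->
  \int[M]_z (h (X z) * h (Y z)) = 0.
Proof.
move=> mX mY mh MAB iXY ih h0.
have mp : measurable_fun setT (fun z => (X z, Y z)) by exact: measurable_fun_pair.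
pose p : {mfun T >-> (S * S)%type} := mfun_Sub (mem_set mp).
pose f (u : S * S) := (h u.1 * h u.2)%:E.
have mf : measurable_fun setT f.
  apply/measurable_EFinP; apply: measurable_funM.
    exact: measurableT_comp.
  exact: measurableT_comp.
have E1 : (\int[distribution M p]_u f u = \int[M]_z (h (X z) * h (Y z))%:E)%E.
  by rewrite integral_distribution.
have uniq D : measurable D -> (mu \x mu)%E D = distribution M p D.
  by move=> mD; apply: product_measure_unique => //.
have E2 : (\int[(mu \x mu)%E]_u f u = \int[distribution M p]_u f u)%E.
  by apply: eq_measure_integral => D mD _; exact: uniq.
have imf : ((mu \x mu)%E).-integrable setT f.
  apply/integrableP; split => //.
  rewrite (@eq_measure_integral _ _ _ setT (distribution M p)); last first.
    by move=> D mD _; exact: uniq.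
  rewrite ge0_integral_distribution//; last by exact: measurableT_comp.
  by have /integrableP[_] := iXY.
rewrite /Rintegral -E1 -E2 -integral12_prod_meas1//.
rewrite /fubini_F /f/=.
under eq_integral do (under eq_integral do rewrite EFinM; rewrite integralZl//).
have hE : (\int[mu]_x (h x)%:E = 0)%E.
  by rewrite -[LHS]fineK ?integrable_fin_num// -/(Rintegral mu setT h) h0.
under eq_integral do rewrite hE mule0.
by rewrite integral0.
Qed.

Section countable_product.
Context {R : realType} {l : R}.
Context (mu : probability (BCborel l) R) (M : probability (BCseq l) R).
Hypothesis prodM : is_countable_product mu M.

Lemma measurable_coord k : measurable_fun setT (fun Z : BCseq l => (Z k : BCborel l)).
Proof.
move=> _ B mB; rewrite setTI; apply: sub_sigma_algebra.
by exists k, B.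
Qed.

Lemma coord_law k (B : set (BCborel l)) : measurable B ->
  M [set Z | B (Z k)] = mu B.
Proof.
move=> mB.
have := prodM k.+1 (fun i => if i == k then B else setT).
rewrite (bigD1 ord_max)//= eqxx big1 ?mule1; last first.
  move=> i ik; rewrite ifF ?probability_setT//; apply/negbTE.
  by apply: contraNN ik => /eqP ik; apply/eqP/val_inj.
move=> <-; last by move=> i; case: ifP.
congr (M _); apply/seteqP; split => Z /=.
  by move=> BZ i _; case: eqP => [->|].
by move/(_ k (ltnSn k)); rewrite eqxx.
Qed.

Lemma coord_pair_law i j (A B : set (BCborel l)) : i != j ->
  measurable A -> measurable B ->
  M ([set Z | A (Z i)] `&` [set Z | B (Z j)]) = (mu A * mu B)%E.
Proof.
move=> ij mA mB; pose n := (maxn i j).+1.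
have iN : (i < n)%N by rewrite ltnS leq_maxl.
have jN : (j < n)%N by rewrite ltnS leq_maxr.
have := prodM n (fun k => if k == i then A else if k == j then B else setT).
rewrite (bigD1 (Ordinal iN))//= eqxx (bigD1 (Ordinal jN))/=; last first.
  by rewrite -val_eqE/= eq_sym.
rewrite eq_sym (negbTE ij) eqxx big1 ?mule1; last first.
  move=> k /andP[ki kj]; rewrite -val_eqE/= in ki; rewrite -val_eqE/= in kj.
  by rewrite (negbTE ki) (negbTE kj) probability_setT.
move=> <-; last by move=> k; case: ifP => // _; case: ifP.
congr (M _); apply/seteqP; split => Z /=.
  by move=> [AZ BZ] k _; case: eqP => [->//|_]; case: eqP => [->|].
move=> H; split.
  by have := H i iN; rewrite eqxx.
by have := H j jN; rewrite eq_sym (negbTE ij) eqxx.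
Qed.

Lemma slln_coord (h : BC l -> R) :
  measurable_fun setT (h : BCborel l -> R) ->
  mu.-integrable setT (EFin \o (fun z => h z ^+ 2)) ->
  mu.-integrable setT (EFin \o h) -> \int[mu]_z h z = 0 ->
  {ae M, forall Z : BCseq l, N.+1%:R^-1 * \sum_(k < N.+1) h (Z k) @[N --> \oo] --> 0}.
Proof.
move=> mh ih2 ih h0.
have mX k : measurable_fun setT (fun Z : BCseq l => h (Z k)).
  exact: (measurableT_comp mh (measurable_coord k)).
have X2 k : (\int[M]_Z (h (Z k) ^+ 2)%:E <= (fine (\int[mu]_z (h z ^+ 2)%:E))%:E)%E.
  rewrite fineK; last by apply: integrable_fin_num.
  pose p : {mfun BCseq l >-> BCborel l} := mfun_Sub (mem_set (measurable_coord k)).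
  rewrite -[leLHS]/(\int[M]_Z ((fun z : BCborel l => (h z ^+ 2)%:E) \o p) Z)%E.
  rewrite -ge0_integral_distribution; last 2 first.
  - by apply/measurable_EFinP; exact: measurable_funX.
  - by move=> z; rewrite lee_fin sqr_ge0.
  rewrite (@eq_measure_integral _ _ _ setT mu)//.
  by move=> B mB _; exact: coord_law.
apply: (@slln_orthogonal _ _ _ M (fun k Z => h (Z k)) _ mX X2) => i j ij.
apply: (@Rintegral_mul_independent _ _ _ _ _ M mu
  (fun Z : BCseq l => (Z i : BCborel l)) (fun Z => (Z j : BCborel l)) h) => //.
- exact: measurable_coord.
- exact: measurable_coord.
- by move=> A B mA mB; exact: coord_pair_law.
- exact: (@integrable_mul _ _ _ M _ _ mX X2).
Qed.

Lemma ae_coord (L : set (BCborel l)) : measurable L -> mu L = 1%E ->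
  {ae M, forall Z : BCseq l, forall k, L (Z k)}.
Proof.
move=> mL L1; apply/ae_foralln => k.
exists [set Z : BCseq l | (~` L) (Z k)]; split => //.
  have := measurable_coord k measurableT (~` L) (measurableC mL).
  by rewrite setTI.
have /= -> := coord_law k (~` L) (measurableC mL).
by rewrite probability_setC// L1 subee.
Qed.

End countable_product.

Section completion.
Context d (T : measurableType d) (R : realType) (M : probability T R).

(** The complement is contained in a null set, hence has outer measure 0, which
    is enough for it to satisfy the Caratheodory criterion. *)
Lemma ae_completed (S : set T) : {ae M, forall Z, S Z} ->
  (M^*)%mu.-cara.-measurable S /\
  @completed_measure_extension _ _ _ M S = 1%E.
Proof.
move=> [N [mN N0 SN]].
have outer0 : (M^*)%mu (~` S) = 0%E.
  apply/eqP; rewrite eq_le; apply/andP; split; last exact: outer_measure_ge0.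
  rewrite -N0 -(measurable_mu_extE M mN).
  exact: le_outer_measure.
split.
  rewrite -(setCK S); apply: caratheodory_measurable_setC.
  apply: le_caratheodory_measurable => X.
  rewrite (_ : _ (X `&` ~` S) = 0%E) ?add0e.
    by apply: le_outer_measure; exact: subIsetl.
  apply/eqP; rewrite eq_le; apply/andP; split; last exact: outer_measure_ge0.
  by rewrite -outer0; apply: le_outer_measure; exact: subIsetr.
rewrite /completed_measure_extension; apply/eqP; rewrite eq_le; apply/andP; split.
  rewrite -(probability_setT M) -(measurable_mu_extE M measurableT).
  exact: le_outer_measure.
rewrite (@le_trans _ _ (M (~` N)))//.
  by rewrite probability_setC// N0 sube0.
rewrite -measurable_mu_extE; last exact: measurableC.
apply: le_outer_measure => Z NZ; apply: contrapT => SZ; apply: NZ.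
exact: SN.
Qed.

End completion.

(** * Consistency of the estimate *)

Section borel.
Context {R : realType} (l : R).
Hypothesis l0 : 0 < l.

Lemma continuous_measurable_BC (h : BC l -> R) : continuous h ->
  measurable_fun setT (h : BCborel l -> R).
Proof.
move=> /continuousP ch; apply: (measurability _ (RGenOpens.measurableE R)).
move=> _ [U oU <-]; rewrite setTI; apply: sub_sigma_algebra.
by apply: ch; case: oU => x [y ->]; exact: interval_open.
Qed.

Lemma closed_measurable_BC (L : set (BC l)) : closed L ->
  measurable (L : set (BCborel l)).
Proof.
move=> cL; rewrite -(setCK L); apply: measurableC.
by apply: sub_sigma_algebra; exact: closed_openC.
Qed.

Lemma continuous_eval0 : continuous (fun f : BC l => f 0).
Proof.
move=> f; apply/(@cvgrPdist_le _ _ _ (nbhs f) _) => e e0; near=> h.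
apply: (@le_trans _ _ `|f - h|).
  have -> : f 0 - h 0 = (f - h) 0 by [].
  by apply: supnorm_ub; rewrite /= in_itv/= oppr_le0 ltW//.
near: h; apply: cvgr_dist_le => //; exact: cvg_id.
Unshelve. all: by end_near. Qed.

(** The coordinate along I of a point of the line g + R I, read off at x = 0. *)
Definition coordinate (g z : BC l) : R := z 0 - g 0.

Lemma continuous_coordinate g : continuous (coordinate g).
Proof.
move=> z; apply: (@cvgB _ _ _ (nbhs z) _ (fun f : BC l => f 0) (cst (g 0))).
  exact: continuous_eval0.
exact: cvg_cst.
Qed.

Lemma coordinate_line g r : coordinate g (g + r *: BC_indic l) = r.
Proof.
rewrite /coordinate BC_addE BC_scaleE BC_indicE ?mulr1; last first.
  by rewrite /= in_itv/= oppr_le0 ltW.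
by rewrite addrC addKr.
Qed.

(** The line is the set where a continuous function vanishes; this makes it
    a Borel set, which supports the law of an observation. *)
Lemma closed_line g : closed [set z : BC l | z = g + coordinate g z *: BC_indic l].
Proof.
pose F z := z - (g + coordinate g z *: BC_indic l).
rewrite (_ : [set z | _] = F @^-1` [set 0]); last first.
  apply/seteqP; split => z /=; first by move=> ->; rewrite /F coordinate_line subrr.
  by move/eqP; rewrite subr_eq0 => /eqP.
apply: closed_comp; last first.
  exact: accessible_closed_set1 (hausdorff_accessible (@norm_hausdorff _ _)) _.
move=> z _.
apply: (@cvgB _ _ _ (nbhs z) _ id (fun z => g + coordinate g z *: BC_indic l)).
  exact: cvg_id.
apply: (@cvgD _ _ _ (nbhs z) _ (cst g) (fun z => coordinate g z *: BC_indic l)).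
  exact: cvg_cst.
by apply: (@cvgZr_tmp _ _ _ (nbhs z) _ (coordinate g)); exact: continuous_coordinate.
Qed.

End borel.

Theorem theorem3p2 (R : realType) (d : measure_display)
    (Omega : measurableType d) (P : probability Omega R)
    (l : R) (m : nat) (A : nat -> R) (sigma : R)
    (W J : R -> {RV P >-> R}) (t0 : R) (theta_star : BC l) :
  0 < l -> (1 <= m)%N -> 0 < A 0%N -> 0 < sigma ->
  wiener_process W ->
  (forall t : R, 0 <= t ->
     is_wiener_integral W (fun tau => expR ((t - tau) * A 0%N)) t (J t)) ->
  0 < t0 ->
  FD0 theta_star ->
  let T := estimate m A t0 theta_star in
  (forall Z : BCseq l, FD0 (T Z)) /\
  (forall theta : BC l, FD0 theta -> regularity m A sigma J theta ->
     forall M : probability (BCseq l) R,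
       is_countable_product (mu_ m A sigma J t0 theta) M ->
       (M^*)%mu.-cara.-measurable [set Z | T Z = theta] /\
       @completed_measure_extension _ _ _ M [set Z | T Z = theta] = 1%E).
Proof.
move=> l0 m1 A0 sigma0 wienerW JW t00 FDstar T; split.
  by move=> Z; rewrite /T /estimate; case: asboolP => [[_ []]|].
move=> theta FDtheta reg M prodM.
have [g [C [cg sC]]] := regularity_summable l m A sigma J l0 m1 theta t0 FDtheta
  reg t00.
have gE : semigroup m A t0 theta = g by apply: semigroup_unique; split.
set mu := mu_ m A sigma J t0 theta in prodM *.
have xiE w : xi m A sigma J theta t0 w = g + (sigma * J t0 w) *: BC_indic l.
  by rewrite /xi gE.
have hxi w : coordinate l g (xi m A sigma J theta t0 w) = sigma * J t0 w.
  by rewrite xiE coordinate_line.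
have mh := continuous_measurable_BC l _ (continuous_coordinate l l0 g).
have [_ J2 J0] := wiener_integral_centered_L2 P W _ t0 (J t0) wienerW
  (JW t0 (ltW t00)).
have iJ := integrable_of_sqr P (J t0) (measurable_funP (J t0)) J2.
apply: ae_completed.
pose L := [set z : BCborel l | z = g + coordinate l g z *: BC_indic l].
have mL : measurable L by apply: closed_measurable_BC; exact: closed_line.
have L1 : mu L = 1%E.
  have -> : mu L = P (xi m A sigma J theta t0 @^-1` L) by [].
  rewrite (_ : _ @^-1` L = setT) ?probability_setT//.
  apply/seteqP; split=> w _; first exact: Logic.I.
  suff : xi m A sigma J theta t0 w =
    g + coordinate l g (xi m A sigma J theta t0 w) *: BC_indic l by [].
  by rewrite hxi; exact: xiE.
have aeL := ae_coord mu M prodM L mL L1.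
have aeS : {ae M, forall Z : BCseq l,
    N.+1%:R^-1 * \sum_(k < N.+1) coordinate l g (Z k) @[N --> \oo] --> 0}.
  apply: (slln_coord mu M prodM (coordinate l g) mh).
  - apply: integrable_pushforward => //.
      by apply/measurable_EFinP; exact: measurable_funX.
    rewrite preimage_setT.
    rewrite (_ : _ \o _ = EFin \o (fun w => sigma ^+ 2 * J t0 w ^+ 2)); last first.
      by apply/funext => w; rewrite /= hxi exprMn.
    exact: integrableZ_EFin.
  - apply: integrable_pushforward => //; first exact/measurable_EFinP.
    rewrite preimage_setT.
    rewrite (_ : _ \o _ = EFin \o (fun w => sigma * J t0 w)); last first.
      by apply/funext => w; rewrite /= hxi.
    exact: integrableZ_EFin.
  - rewrite /Rintegral integral_distribution; last 2 first.
    + exact/measurable_EFinP.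
    + rewrite (_ : _ \o _ = EFin \o (fun w => sigma * J t0 w)); last first.
        by apply/funext => w; rewrite /= hxi.
      exact: integrableZ_EFin.
    rewrite (_ : _ \o _ = EFin \o (fun w => sigma * J t0 w)); last first.
      by apply/funext => w; rewrite /= hxi.
    by rewrite -/(Rintegral P setT (fun w => sigma * J t0 w)) RintegralZl// J0 mulr0.
apply: filterS2 aeL aeS => Z LZ SZ.
exact: (estimate_consistent l m A l0 theta theta_star g C t0 Z
  (fun k => coordinate l g (Z k)) FDtheta sC cg LZ SZ).
Qed.
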